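(* Let $\mathscr{A}$ be a commutative unital $C^*$-algebra generated by an element $t\in\mathscr{A}$ (i.e. $\mathscr{A}=C^*(t)$), and let $\Xi\subseteq\mathbb{Z}_+^2$ be a set for which there exist $p,q,r\in\mathbb{Z}_+$ such that $p\neq q$, $p+q<2r$ and $(p,q),(r,r)\in\Xi$. If $G:=\{t^{*m}t^n\colon (m,n)\in\Xi\}$ generates $\mathscr{A}$ (i.e. $\mathscr{A}=C^*(G)$), then $G$ is hyperrigid in $\mathscr{A}$.
   Context: $\mathbb{Z}_+$ is the set of nonnegative integers. Hilbert spaces are complex; $\boldsymbol{B}(\mathcal{H})$ is the $C^*$-algebra of bounded linear operators on $\mathcal{H}$. For a unital $C^*$-algebra $\mathscr{A}$ with unit $e$ and nonempty $G\subseteq\mathscr{A}$ (not necessarily containing $e$), $C^*(G)$ is the smallest $C^*$-subalgebra of $\mathscr{A}$ containing $G\cup\{e\}$; $C^*(t)=C^*(\{t\})$; $G$ generates $\mathscr{A}$ if $\mathscr{A}=C^*(G)$. By convention $t^0=t^{*0}=e$. Completely positive maps are linear; UCP means unital completely positive; representations of unital $C^*$-algebras are unital $*$-homomorphisms into $\boldsymbol{B}(\mathcal{H})$. Hyperrigidity: a nonempty subset $G$ of a unital $C^*$-algebra $\mathscr{A}$ is hyperrigid (in $\mathscr{A}$) if for any faithful representation $\pi\colon\mathscr{A}\to\boldsymbol{B}(\mathcal{H})$ on a Hilbert space $\mathcal{H}$ and any sequence $\Phi_k\colon\boldsymbol{B}(\mathcal{H})\to\boldsymbol{B}(\mathcal{H})$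 ($k\in\mathbb{N}$) of UCP maps, if $\lim_{k\to\infty}\|\Phi_k(\pi(g))-\pi(g)\|=0$ for all $g\in G$, then $\lim_{k\to\infty}\|\Phi_k(\pi(a))-\pi(a)\|=0$ for all $a\in\mathscr{A}$. ($G$ is not required to be countable or to generate $\mathscr{A}$.) *)

(* Defs.v *)
From HB Require Import structures.
From mathcomp Require Import all_boot all_order all_algebra.
From mathcomp Require Import sesquilinear.
From mathcomp Require Import complex.
From mathcomp Require Import all_classical all_reals all_analysis.

Set Implicit Arguments.
Unset Strict Implicit.
Unset Printing Implicit Defensive.

Import Order.TTheory GRing.Theory Num.Theory.
Import numFieldNormedType.Exports.

Local Open Scope classical_set_scope.
Local Open Scope ring_scope.

(* Unital complex C*-algebras, the zero algebra included.  The norm of a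
   [normedModType R[i]] takes its (real) values in [R[i]].  Hierarchy-Builder
   cannot join normed modules with rings, because [numDomainType] already
   inherits from both, so the product is part of the mixin and the library's
   ring structure is derived from it below. *)
HB.mixin Record isCStarAlgebra (R : realType) A
    of CompleteNormedModule R[i] A := {
  cstar_one : A;
  cstar_mul : A -> A -> A;
  star : A -> A;
  cstar_mulA : associative cstar_mul;
  cstar_mul1l : left_id cstar_one cstar_mul;
  cstar_mul1r : right_id cstar_one cstar_mul;
  cstar_mulDl : left_distributive cstar_mul +%R;
  cstar_mulDr : right_distributive cstar_mul +%R;
  cstar_scaleAl : forall (c : R[i]) (a b : A),
    c *: cstar_mul a b = cstar_mul (c *: a) b;
  cstar_scaleAr : forall (c : R[i]) (a b : A),
    c *: cstar_mul a b = cstar_mul a (c *: b);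
  starD : forall a b : A, star (a + b) = star a + star b;
  starZ : forall (c : R[i]) (a : A), star (c *: a) = Num.conj c *: star a;
  starM : forall a b : A, star (cstar_mul a b) = cstar_mul (star b) (star a);
  starK : involutive star;
  cstar_normM : forall a b : A, `|cstar_mul a b| <= `|a| * `|b|;
  cstar_norm_star : forall a : A, `|cstar_mul (star a) a| = `|a| ^+ 2
}.

#[short(type="cstarAlgType")]
HB.structure Definition CStarAlgebra (R : realType) :=
  { A of isCStarAlgebra R A & CompleteNormedModule R[i] A }.

HB.instance Definition _ (R : realType) (A : cstarAlgType R) :=
  GRing.Zmodule_isPzRing.Build (CStarAlgebra.sort A)
    (@cstar_mulA R A) (@cstar_mul1l R A) (@cstar_mul1r R A)
    (@cstar_mulDl R A) (@cstar_mulDr R A).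

(* The inner product is linear in its first argument. *)
HB.mixin Record isHilbert (R : realType) H of CompleteNormedModule R[i] H := {
  inner : {dot H for (Num.conj : R[i] -> R[i])};
  norm_inner : forall x : H, `|x| ^+ 2 = inner x x
}.

#[short(type="hilbertType")]
HB.structure Definition Hilbert (R : realType) :=
  { H of isHilbert R H & CompleteNormedModule R[i] H }.

Arguments inner {R s}.

Section CStarSubalgebra.
Context {R : realType} {A : cstarAlgType R}.

Record cstar_subalgebra (S : set A) : Prop := {
  csubD : forall a b, S a -> S b -> S (a + b);
  csubZ : forall (c : R[i]) a, S a -> S (c *: a);
  csubM : forall a b, S a -> S b -> S (a * b);
  csub_star : forall a, S a -> S (star a);
  csub_closed : closed S
}.

Definition cstar_gen (G : set A) : set A :=
  smallest cstar_subalgebra (G `|` [set 1]).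

Definition generates (G : set A) := cstar_gen G = [set: A].

End CStarSubalgebra.

Section BoundedOperators.
Context {R : realType} (H : hilbertType R).

Definition bounded_linear : {pred H -> H} :=
  [pred f | `[< linear f /\
                exists M : R[i], forall x : H, `|f x| <= M * `|x| >]].

Record bop := Bop { bop_fun :> H -> H; _ : bop_fun \in bounded_linear }.

HB.instance Definition _ := [isSub for bop_fun].
HB.instance Definition _ := [Choice of bop by <:].

Lemma bopP (T : bop) :
  linear T /\ exists M : R[i], forall x : H, `|T x| <= M * `|x|.
Proof. by case: T => f /= /asboolP. Qed.

Lemma bounded_linear_submod : submod_closed bounded_linear.
Proof.
split.
  apply/asboolP; split=> [c x y|]; first by rewrite /= scaler0 addr0.
  by exists 0 => x; rewrite normr0 mul0r.
move=> c f g /asboolP[fL [M fM]] /asboolP[gL [N gN]].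
apply/asboolP; split=> [d x y|].
  rewrite !fctE fL gL !scalerDr !scalerA (mulrC c d) -!scalerA.
  by rewrite addrACA.
exists (`|c| * M + N) => x; rewrite fctE mulrDl (le_trans (ler_normD _ _))//.
by rewrite lerD// normrZ -mulrA ler_wpM2l.
Qed.

HB.instance Definition _ :=
  GRing.isSubmodClosed.Build R[i] (H -> H) bounded_linear bounded_linear_submod.
HB.instance Definition _ := [SubChoice_isSubLmodule of bop by <:].

Lemma bop_one_subproof : idfun \in bounded_linear.
Proof. by apply/asboolP; split=> //; exists 1 => x; rewrite mul1r. Qed.

Lemma bop_comp_subproof (S T : bop) : (S \o T : H -> H) \in bounded_linear.
Proof.
have [SL [M SM]] := bopP S; have [TL [N TN]] := bopP T.
apply/asboolP; split=> [c x y|] /=; first by rewrite TL SL.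
exists (`|M| * N) => x.
have MT : M * `|T x| <= `|M| * `|T x|.
  have /real_ler_norm : M * `|T x| \is Num.real.
    by apply: ger0_real; apply: le_trans (SM _).
  by rewrite normrM normr_id.
by rewrite (le_trans (SM _))// (le_trans MT)// -mulrA ler_wpM2l.
Qed.

Definition bop_one := Bop bop_one_subproof.
Definition bop_comp (S T : bop) := Bop (bop_comp_subproof S T).

Lemma bop_compA : associative bop_comp.
Proof. by move=> S T U; apply: val_inj. Qed.
Lemma bop_comp1l : left_id bop_one bop_comp.
Proof. by move=> S; apply: val_inj. Qed.
Lemma bop_comp1r : right_id bop_one bop_comp.
Proof. by move=> S; apply: val_inj. Qed.
Lemma bop_compDl : left_distributive bop_comp +%R.
Proof. by move=> S T U; apply: val_inj. Qed.
Lemma bop_compDr : right_distributive bop_comp +%R.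
Proof.
move=> S T U; apply: val_inj; apply/funext => x /=.
by have [SL _] := bopP S; have := SL 1 (T x) (U x); rewrite !scale1r.
Qed.

HB.instance Definition _ := GRing.Zmodule_isPzRing.Build bop
  bop_compA bop_comp1l bop_comp1r bop_compDl bop_compDr.

Definition opnorm (T : bop) : R :=
  sup [set complex.Re `|T x| | x in [set x : H | `|x| <= 1]].

Definition is_adjoint (S T : bop) : Prop :=
  forall x y : H, inner (T x) y = inner x (S y).

(* Positivity of an operator matrix, an element of M_n(B(H)) = B(H^n); in
   [R[i]], [0 <= z] says that z is real and nonnegative. *)
Definition mx_positive n (T : 'I_n -> 'I_n -> bop) : Prop :=
  forall x : 'I_n -> H, 0 <= \sum_i \sum_j inner (T i j (x j)) (x i).

Definition completely_positive (Phi : bop -> bop) : Prop :=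
  linear Phi /\
  forall n (T : 'I_n -> 'I_n -> bop),
    mx_positive T -> mx_positive (fun i j => Phi (T i j)).

Definition ucp (Phi : bop -> bop) : Prop :=
  completely_positive Phi /\ Phi 1 = 1.

End BoundedOperators.

Section Hyperrigidity.
Context {R : realType} {A : cstarAlgType R}.

Definition representation (H : hilbertType R) (pi : A -> bop H) : Prop :=
  [/\ linear pi, monoid_morphism pi &
      forall a, is_adjoint (pi (star a)) (pi a)].

Definition faithful_representation (H : hilbertType R) (pi : A -> bop H) :=
  representation pi /\ injective pi.

Definition hyperrigid (G : set A) : Prop :=
  G !=set0 /\
  forall (H : hilbertType R) (pi : A -> bop H) (Phi : nat -> bop H -> bop H),
    faithful_representation pi ->
    (forall k, ucp (Phi k)) ->
    (forall g, G g ->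
      (fun k => opnorm (Phi k (pi g) - pi g)) @ \oo --> (0 : R)) ->
    forall a, (fun k => opnorm (Phi k (pi a) - pi a)) @ \oo --> (0 : R).

End Hyperrigidity.

(* Main.v *)
Require Import Defs.
From mathcomp Require Import all_boot all_order all_algebra.
From mathcomp Require Import complex.
From mathcomp Require Import ring lra zify.
From mathcomp Require Import all_classical all_reals all_analysis.

Set Implicit Arguments.
Unset Strict Implicit.
Unset Printing Implicit Defensive.

Import Order.TTheory GRing.Theory Num.Theory.
Import numFieldNormedType.Exports.

Local Open Scope classical_set_scope.
Local Open Scope ring_scope.

(* Write [c = t^* t] and [Psi_k = Phi_k o pi], and let [X ~ Y] mean that
   [X_k - Y_k] tends to [0] in norm.
   (1) If [Psi_k (c^r) ~ c^r], then [Psi_k (c^j) <= (c + e)^j] eventually, for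
   every [j <= r] and [e > 0]: the least constants [M_j] with
   [Psi_k (c^j) <= M_j (c + e)^j] form a log-convex sequence with
   [M_0, M_r <= 1].
   (2) Split [t^*^p t^q = x^* y] into monomials with [x^* x = c^d],
   [y^* y = c^e] and [d < e <= r].  By (1) the 2x2 operator matrix of the
   [Psi_k] of [x^* x, x^* y, y^* x, y^* y] is asymptotically dominated by a
   matrix that kills [(y, -x)], whence [Psi_k (z x) y ~ Psi_k (z y) x] for all
   [z], and so [Psi_k (z c^d) c^e ~ Psi_k (z c^e) c^d].
   (3) Iterating gives [Psi_k (c^n) ~ c^n] for [n] in the arithmetic progression
   [d + (e - d) N], so (1) applies to every power of [c].
   (4) For [g] in [G] the Schwarz inequality then gives
   [Psi_k (z g) ~ Psi_k (z) g] for all [z], and the elements with this property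
   (together with their adjoints) form a C*-subalgebra. *)

(** * Quadratic inequalities, and real-valued norms and inner products *)

Lemma discriminant_le (R : realFieldType) (a b d : R) :
  (forall s, 0 <= a * s ^+ 2 + 2 * b * s + d) -> b ^+ 2 <= a * d.
Proof.
move=> h; have d0 : 0 <= d by have := h 0; rewrite expr0n /= !mulr0 !add0r.
have [a0|a0|a0] := ltgtP a 0.
(* Adding the values at [s] and [- s] removes the linear term, and this [s] makes [a * s ^+ 2 + d]
   negative. *)
- exfalso; set s := d / - a + 1.
  have sa : a * (s - 1) = - d.
    by rewrite /s addrK invrN mulrN mulrN mulrC divfK// lt_eqF.
  have s1 : 1 <= s by rewrite /s lerDr divr_ge0// oppr_ge0 ltW.
  have := h s; have := h (- s); nra.
- have := h (- b / a); set s := _ / _ => hs.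
  have sa : s * a = - b by rewrite /s divfK// gt_eqF.
  have : 0 <= (a * s ^+ 2 + 2 * b * s + d) * a by rewrite mulr_ge0// ltW.
  nra.
- rewrite a0 mul0r; have [->|b0] := eqVneq b 0; first by rewrite expr0n.
  exfalso; have := h (- (d + 1) / (2 * b)); rewrite a0 mul0r add0r.
  rewrite mulrCA mulfV; last by rewrite mulf_neq0.
  by lra.
Qed.

Section RealNorm.
Context {R : realType} {V : normedModType R[i]}.
Implicit Types x y : V.

(** Norms live in [R[i]]; their real parts lie in a totally ordered field, where [lra] and [nra]
    apply. *)
Definition nrm x : R := complex.Re `|x|.

Lemma nrmE x : `|x| = (nrm x)%:C%C.
Proof. by rewrite /nrm RRe_real// normr_real. Qed.

Lemma nrm_ge0 x : 0 <= nrm x.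
Proof. by rewrite -ler0c -nrmE normr_ge0. Qed.

Lemma nrm0 : nrm (0 : V) = 0.
Proof. by rewrite /nrm normr0. Qed.

Lemma nrm_eq0 x : nrm x = 0 -> x = 0.
Proof. by move=> x0; apply/eqP; rewrite -normr_eq0 nrmE x0. Qed.

Lemma nrmN x : nrm (- x) = nrm x.
Proof. by rewrite /nrm normrN. Qed.

Lemma nrmD x y : nrm (x + y) <= nrm x + nrm y.
Proof. by rewrite -lecR rmorphD /= -!nrmE ler_normD. Qed.

Lemma nrmB x y : nrm (x - y) <= nrm x + nrm y.
Proof. by rewrite -(nrmN y) nrmD. Qed.

Lemma nrmZ (c : R) x : nrm (c%:C%C *: x) = `|c| * nrm x.
Proof.
apply: complexI; rewrite rmorphM /= -!nrmE normrZ; congr (_ * _).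
by rewrite normc_def /= expr0n addr0 sqrtr_sqr.
Qed.

Lemma nrmZC (c : R[i]) x : nrm (c *: x) = complex.Re `|c| * nrm x.
Proof.
apply: complexI; rewrite rmorphM /= -!nrmE normrZ; congr (_ * _).
Qed.

End RealNorm.

Lemma Re_conj (R : realType) (z : R[i]) : complex.Re (Num.conj z) = complex.Re z.
Proof. by case: z. Qed.

Section RealInner.
Context {R : realType} {H : hilbertType R}.
Implicit Types x y z : H.

(** Real parts turn the sesquilinear product into a symmetric real bilinear form with the same
    norm. *)
Definition rip x y : R := complex.Re (inner x y).

Lemma rip_sq x : rip x x = nrm x ^+ 2.
Proof. by rewrite /rip -norm_inner nrmE -rmorphXn. Qed.

Lemma ripC x y : rip x y = rip y x.
Proof.
rewrite /rip (@hermC _ _ _ _ inner x y) expr0 mul1r.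
exact: Re_conj.
Qed.

Lemma ripDl x y z : rip (x + y) z = rip x z + rip y z.
Proof. by rewrite /rip linearDl raddfD. Qed.

Lemma ripNl x z : rip (- x) z = - rip x z.
Proof. by rewrite /rip linearNl raddfN. Qed.

Lemma ripZl (c : R) x z : rip (c%:C%C *: x) z = c * rip x z.
Proof.
rewrite /rip linearZl_LR /=; case: (inner x z) => a b /=.
by rewrite mul0r subr0.
Qed.

Lemma ripBl x y z : rip (x - y) z = rip x z - rip y z.
Proof. by rewrite ripDl ripNl. Qed.

Lemma ripDr x y z : rip z (x + y) = rip z x + rip z y.
Proof. by rewrite ripC ripDl !(ripC z). Qed.

Lemma ripNr x z : rip z (- x) = - rip z x.
Proof. by rewrite ripC ripNl ripC. Qed.

Lemma ripBr x y z : rip z (x - y) = rip z x - rip z y.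
Proof. by rewrite ripDr ripNr. Qed.

Lemma ripZr (c : R) x z : rip z (c%:C%C *: x) = c * rip z x.
Proof. by rewrite ripC ripZl ripC. Qed.

Lemma rip0l z : rip 0 z = 0.
Proof. by rewrite -(subrr z) ripBl subrr. Qed.

Lemma rip0r z : rip z 0 = 0.
Proof. by rewrite ripC rip0l. Qed.

Lemma rip_ge0 x : 0 <= rip x x.
Proof. by rewrite rip_sq sqr_ge0. Qed.

Lemma rip_CS x y : rip x y <= nrm x * nrm y.
Proof.
have : rip x y ^+ 2 <= rip x x * rip y y.
  apply: discriminant_le => s; have := rip_ge0 (s%:C%C *: x + y).
  by rewrite !(ripDl, ripDr, ripZl, ripZr) (ripC y x); lra.
rewrite !rip_sq -exprMn; have [h _|h] := leP (rip x y) 0.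
  by rewrite (le_trans h)// mulr_ge0 ?nrm_ge0.
by rewrite ler_pXn2r// nnegrE ?mulr_ge0 ?nrm_ge0// ltW.
Qed.

Lemma rip_CSN x y : - rip x y <= nrm x * nrm y.
Proof. by rewrite -ripNl -(nrmN x) rip_CS. Qed.

Lemma nrm_le x (M : R) : 0 <= M -> rip x x <= M ^+ 2 -> nrm x <= M.
Proof. by move=> M0; rewrite rip_sq ler_pXn2r// nnegrE nrm_ge0. Qed.

End RealInner.

Section BoundedOperatorTheory.
Context {R : realType} {H : hilbertType R}.
Implicit Types (S T : bop H) (x y : H).

Lemma bop_mulE S T x : (S * T) x = S (T x). Proof. by []. Qed.
Lemma bop_subE S T x : (S - T) x = S x - T x. Proof. by []. Qed.
Lemma bop_scaleE c T x : (c *: T) x = c *: T x. Proof. by []. Qed.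
Lemma bop_1E x : (1 : bop H) x = x. Proof. by []. Qed.
Lemma bop_0E x : (0 : bop H) x = 0. Proof. by []. Qed.

Lemma bopD T x y : T (x + y) = T x + T y.
Proof. by have [TL _] := bopP T; rewrite -[x]scale1r TL !scale1r. Qed.

Lemma bop0 T : T 0 = 0.
Proof. by apply: (@addrI _ (T 0)); rewrite -bopD !addr0. Qed.

Lemma bopZ T c x : T (c *: x) = c *: T x.
Proof. by have [TL _] := bopP T; rewrite -[c *: x]addr0 TL bop0 addr0. Qed.

Lemma bopN T x : T (- x) = - T x.
Proof. by rewrite -scaleN1r bopZ scaleN1r. Qed.

Lemma bopB T x y : T (x - y) = T x - T y.
Proof. by rewrite bopD bopN. Qed.

Lemma bop_bounded T : exists2 M : R, 0 < M & forall x, nrm (T x) <= M * nrm x.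
Proof.
(* The [+ 1] makes the bound positive, so that it can serve as a divisor. *)
have [_ [M TM]] := bopP T; exists (`|complex.Re M| + 1) => [|x].
  by rewrite ltr_wpDl.
have : nrm (T x) <= complex.Re M * nrm x.
  have := TM x; rewrite !nrmE lecE => /andP[_ /=].
  by case: (M) => a b /=; rewrite mulr0 subr0.
move=> /le_trans; apply; rewrite ler_wpM2r ?nrm_ge0//.
by rewrite (le_trans (ler_norm _))// lerDl.
Qed.

End BoundedOperatorTheory.

(** * Fixed points of contractions *)

Lemma geometric_small (R : realType) (K q e : R) :
  0 <= K -> 0 <= q < 1 -> 0 < e ->
  exists N, forall n, (N <= n)%N -> K * q ^+ n < e.
Proof.
move=> K0 /andP[q0 q1] e0.
have : (fun n => q ^+ n) @ \oo --> 0 by apply: cvg_expr; rewrite ger0_norm.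
move=> /cvgrPdist_lt /(_ (e / (K + 1))) []; first by rewrite divr_gt0// ltr_wpDl.
move=> N _ hN; exists N => n /hN /=.
rewrite sub0r normrN ger0_norm ?exprn_ge0// ltr_pdivlMr ?ltr_wpDl// => h.
by rewrite (le_lt_trans _ h)// mulrC ler_wpM2l ?exprn_ge0// lerDl.
Qed.

Section FixedPoint.
Context {R : realType} {V : completeNormedModType R[i]}.

(** Picard iteration from [x0]. It serves twice: for square roots in the algebra and for solving
    linear equations in the Hilbert space. *)
Lemma contraction_fixed_point (U : set V) (f : V -> V) (q : R) (x0 : V) :
  U x0 -> (forall x, U x -> U (f x)) -> 0 <= q < 1 ->
  (forall x y, U x -> U y -> nrm (f x - f y) <= q * nrm (x - y)) ->
  (forall l, (forall e, 0 < e -> exists2 x, U x & nrm (l - x) <= e) -> U l) ->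
  exists2 x, U x & f x = x.
Proof.
move=> Ux0 Uf /[dup] q01 /andP[q0 q1] fq Ucl; pose u n := iter n f x0.
have Uu n : U (u n) by elim: n => //= n; exact: Uf.
have step n : nrm (u n.+1 - u n) <= nrm (f x0 - x0) * q ^+ n.
  elim: n => [|n ih]; first by rewrite expr0 mulr1.
  rewrite exprS mulrCA -[u n.+2]/(f (u n.+1)) -[u n.+1 in X in _ - X]/(f (u n)).
  by apply: le_trans (fq _ _ (Uu n.+1) (Uu n)) _; rewrite ler_wpM2l.
set C := nrm (f x0 - x0) in step; pose K := C / (1 - q).
have K0 : 0 <= K by rewrite divr_ge0 ?nrm_ge0// subr_ge0 ltW.
(* The geometric sum is kept in closed form, so that the induction on [m] telescopes exactly. *)
have dist n m : nrm (u (n + m)%N - u n) <= K * (q ^+ n - q ^+ (n + m)).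
  elim: m => [|m ih]; first by rewrite addn0 !subrr nrm0 mulr0.
  have -> : K * (q ^+ n - q ^+ (n + m.+1)) =
      C * q ^+ (n + m) + K * (q ^+ n - q ^+ (n + m)).
    rewrite /K addnS exprS; field.
    by rewrite gt_eqF// subr_gt0.
  rewrite -[u (n + m.+1)%N](subrK (u (n + m)%N)) -addrA (le_trans (nrmD _ _))//.
  by rewrite lerD// addnS.
have distle N n m : (N <= n)%N -> (N <= m)%N ->
    nrm (u n - u m) <= 2 * (K * q ^+ N).
  move=> Nn Nm.
  have far k : (N <= k)%N -> nrm (u k - u N) <= K * q ^+ N.
    move=> Nk; rewrite -(subnKC Nk); apply: le_trans (dist _ _) _.
    by rewrite ler_wpM2l// lerBlDr lerDl exprn_ge0.
  have -> : u n - u m = (u n - u N) - (u m - u N) by rewrite opprB addrA subrK.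
  by rewrite (le_trans (nrmB _ _))// mulr_natl mulr2n lerD// far.
have ucvg : cvgn u.
  apply/cauchy_cvgP/cauchy_ballP => e e0.
  have eE : e = (complex.Re e)%:C%C by rewrite RRe_real// gtr0_real.
  have e0' : 0 < complex.Re e by rewrite -ltcR -eE.
  have K20 : 0 <= 2 * K by rewrite mulr_ge0.
  have [N hN] := geometric_small K20 q01 e0'.
  pose T := u @` [set n | (N <= n)%N].
  have uT : \forall n \near \oo, T (u n) by exists N => // n Nn; exists n.
  exists (T, T) => // -[_ _] [[n Nn <-] [m Nm <-]] /=.
  rewrite -ball_normE /= nrmE eE ltcR.
  by apply: le_lt_trans (hN N (leqnn N)); rewrite -mulrA; exact: distle.
have ulim e : 0 < e -> exists N, forall n, (N <= n)%N -> nrm (limn u - u n) <= e.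
  move=> e0; move/cvgrPdist_lt : ucvg => /(_ e%:C%C) []; first by rewrite ltcR.
  by move=> N _ hN; exists N => n /hN /=; rewrite nrmE ltcR => /ltW.
have Ul : U (limn u).
  by apply: Ucl => e /ulim[N /(_ N (leqnn N)) ?]; exists (u N).
exists (limn u) => //; apply/eqP; rewrite -subr_eq0; apply/eqP/nrm_eq0/eqP.
rewrite eq_le nrm_ge0 andbT leNgt; apply/negP => d0.
(* With [d] the distance from [limn u] to its image, a tolerance [d / 4] gives [d <= d / 4 + d / 4],
   which is absurd. *)
have [N hN] := ulim _ (divr_gt0 d0 (ltr0n R 4)).
have h1 := hN N (leqnn N); have h2 := hN N.+1 (leqnSn N).
have h3 := fq _ _ Ul (Uu N); rewrite -[f (u N)]/(u N.+1) in h3.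
have : nrm (f (limn u) - limn u) <=
    nrm (f (limn u) - u N.+1) + nrm (limn u - u N.+1).
  by apply: le_trans (nrmB _ _); rewrite opprB addrA subrK.
have : q * nrm (limn u - u N) <= nrm (limn u - u N).
  by rewrite ler_piMl ?nrm_ge0// ltW.
by lra.
Qed.

End FixedPoint.

(** * The norm of a C*-algebra and square roots near the unit *)

Section CStarNorm.
Context {R : realType} {A : cstarAlgType R}.
Implicit Types a b : A.

Lemma cscaleAr (c : R[i]) a b : c *: (a * b) = a * (c *: b).
Proof. exact: cstar_scaleAr. Qed.

Lemma cstarM a b : star (a * b) = star b * star a.
Proof. exact: starM. Qed.

Lemma cstar1 : star (1 : A) = 1.
Proof.
have : star (1 * star (1 : A)) = 1 by rewrite mul1r starK.
by rewrite cstarM starK mul1r.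
Qed.

Lemma cstar0 : star (0 : A) = 0.
Proof. by rewrite -(scale0r (0 : A)) starZ rmorph0 !scale0r. Qed.

Lemma cstarN a : star (- a) = - star a.
Proof. by apply: (@addrI _ (star a)); rewrite -starD !subrr cstar0. Qed.

Lemma cstarB a b : star (a - b) = star a - star b.
Proof. by rewrite starD cstarN. Qed.

Lemma cstarX a n : star (a ^+ n) = star a ^+ n.
Proof.
by elim: n => [|n ih]; rewrite ?expr0 ?cstar1// exprSr cstarM ih -exprS.
Qed.

Lemma conj_realC (x : R) : Num.conj (x%:C%C : R[i]) = x%:C%C.
Proof. exact: conjc_real. Qed.

Lemma nrmM a b : nrm (a * b) <= nrm a * nrm b.
Proof. by rewrite -lecR rmorphM /= -!nrmE; exact: cstar_normM. Qed.

Lemma nrm_starM a : nrm (star a * a) = nrm a ^+ 2.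
Proof.
by apply: complexI; rewrite rmorphXn /= -!nrmE; exact: cstar_norm_star.
Qed.

Lemma nrm_star a : nrm (star a) = nrm a.
Proof.
have le b : nrm b <= nrm (star b).
  have [->|b0] := eqVneq (nrm b) 0; first exact: nrm_ge0.
  have b_gt0 : 0 < nrm b by rewrite lt_def b0 nrm_ge0.
  by rewrite -(ler_pM2r b_gt0) -expr2 -nrm_starM nrmM.
by apply/eqP; rewrite eq_le le andbT -{2}(starK a) le.
Qed.

(* The power series of [1 - sqrt (1 - b)], as a fixed point. *)
Lemma self_adjoint_sqrt b : (forall x y : A, x * y = y * x) ->
  star b = b -> nrm b < 1 ->
  exists2 y, star y = y & 1 - b = (1 - y) * (1 - y).
Proof.
move=> commA sb b1; pose h : R[i] := (2^-1 : R)%:C%C.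
have nrmh (x : A) : nrm (h *: x) = 2^-1 * nrm x.
  by rewrite nrmZ ger0_norm// invr_ge0.
have hh (x : A) : h *: x + h *: x = x.
  rewrite -scalerDl -[RHS]scale1r; congr (_ *: _); rewrite /h -rmorphD /=.
  by rewrite -(rmorph1 (real_complex R)); congr (_%:C%C); lra.
(* A fixed point satisfies [y + y = b + y * y], that is [(1 - y) * (1 - y) = 1 - b]. Since
   [f x - f y] is half of [(x + y) * (x - y)], the map contracts by [nrm b] on the ball of that
   radius. *)
pose f y : A := h *: (b + y * y).
pose U : set A := [set y | nrm y <= nrm b].
have b0 := nrm_ge0 b.
have sqB (x y : A) : x * x - y * y = (x + y) * (x - y).
  by rewrite mulrBr !mulrDl (commA y x) opprD addrA addrK.
have fL x y : U x -> U y -> nrm (f x - f y) <= nrm b * nrm (x - y).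
  move=> Ux Uy; rewrite /f -scalerBr nrmh opprD addrACA subrr add0r sqB.
  have := nrmM (x + y) (x - y); have := nrmD x y; have := nrm_ge0 (x - y).
  by rewrite /U /= in Ux Uy; nra.
have [||||y Uy fy] := @contraction_fixed_point R A U f (nrm b) 0 _ _ _ fL.
- by rewrite /U /= nrm0.
- move=> x; rewrite /U /= /f nrmh => xb.
  have := nrmD b (x * x); have := nrmM x x; have := nrm_ge0 x; nra.
- by rewrite b0.
- move=> l hl; rewrite /U /=; apply/ler_addgt0Pr => e /hl[x Ux lx].
  by have := nrmD (l - x) x; rewrite subrK; rewrite /U /= in Ux; lra.
(* [star y] is a fixed point in the same ball, hence equal to [y]. *)
have ysy : star y = y.
  have Usy : U (star y) by rewrite /U /= nrm_star.
  have fsy : f (star y) = star y.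
    by rewrite -[in RHS]fy /f starZ conj_realC starD cstarM sb.
  have := fL _ _ Usy Uy; rewrite fsy fy => h1.
  apply/eqP; rewrite -subr_eq0; apply/eqP/nrm_eq0.
  have := nrm_ge0 (star y - y); nra.
have yy : y + y = b + y * y by rewrite -[RHS]hh -/(f y) fy.
exists y => //; rewrite mulrBl mul1r mulrBr mulr1 opprB addrA.
have -> : y * y = y + y - b by rewrite yy addrAC subrr add0r.
by rewrite addrAC -(addrA 1 (- y)) -opprD addrA subrK.
Qed.

End CStarNorm.

(** * Representations: contractivity, and surjectivity of shifted positive operators *)

Section Representation.
Context {R : realType} {A : cstarAlgType R} {H : hilbertType R}.
Context {rho : A -> bop H}.
Hypothesis rp : representation rho.
Implicit Types (a b w : A) (x y : H).

Lemma repZ c a : rho (c *: a) = c *: rho a.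
Proof.
case: rp => lp _ _; have p0 : rho 0 = 0.
  by have := lp (-1) 0 0; rewrite scaler0 addr0 scaleN1r addNr.
by rewrite -[c *: a]addr0 lp p0 addr0.
Qed.

Lemma repD a b : rho (a + b) = rho a + rho b.
Proof. by case: rp => lp _ _; rewrite -[a]scale1r lp !scale1r. Qed.

Lemma repB a b : rho (a - b) = rho a - rho b.
Proof. by rewrite repD -scaleN1r repZ scaleN1r. Qed.

Lemma repM a b : rho (a * b) = rho a * rho b.
Proof. by case: rp => _ []. Qed.

Lemma rep1 : rho 1 = 1.
Proof. by case: rp => _ []. Qed.

Lemma repM_apply a b x : rho (a * b) x = rho a (rho b x).
Proof. by rewrite repM. Qed.

Lemma rep_adj a x y : rip (rho a x) y = rip x (rho (star a) y).
Proof. by case: rp => _ _ adj; rewrite /rip adj. Qed.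

Lemma rep_adj' a x y : rip (rho (star a) x) y = rip x (rho a y).
Proof. by rewrite rep_adj starK. Qed.

Lemma rip_starM a x : rip (rho (star a * a) x) x = nrm (rho a x) ^+ 2.
Proof. by rewrite repM_apply rep_adj' rip_sq. Qed.

(** For [nrm a < 1], [1 - star a * a] is the square of a self-adjoint [1 - y], so
    [nrm x ^+ 2 - nrm (rho a x) ^+ 2] equals [nrm (rho (1 - y) x) ^+ 2]. Scaling does the rest. *)
Lemma rep_contractive : (forall a b, a * b = b * a) ->
  forall a x, nrm (rho a x) <= nrm a * nrm x.
Proof.
move=> commA; have unit_ball a x : nrm a < 1 -> nrm (rho a x) <= nrm x.
  move=> a1; have [||y sy yE] := @self_adjoint_sqrt R A (star a * a) commA.
  - by rewrite cstarM starK.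
  - by rewrite nrm_starM; have := nrm_ge0 a; nra.
  have := rip_starM (1 - y) x; rewrite cstarB cstar1 sy -yE.
  rewrite repB rep1 bop_subE ripBl rip_starM bop_1E rip_sq => h.
  apply: nrm_le; first exact: nrm_ge0.
  by rewrite rip_sq -subr_ge0 h sqr_ge0.
move=> a x; apply/ler_addgt0Pr => e e0.
(* [M] exceeds [nrm a] strictly, and the excess costs at most [e] once multiplied by [nrm x]. *)
pose M := nrm a + e / (nrm x + 1).
have x1 : 0 < nrm x + 1 by rewrite ltr_wpDl ?nrm_ge0.
have d0 : 0 < e / (nrm x + 1) by rewrite divr_gt0.
have M0 : 0 < M by rewrite ltr_wpDl ?nrm_ge0.
have := unit_ball (M^-1%:C%C *: a) x.
rewrite repZ bop_scaleE !nrmZ ger0_norm ?invr_ge0 ?(ltW M0)//.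
rewrite mulrC ltr_pdivrMr// mul1r /M ltrDl d0 => /(_ isT).
rewrite -/M mulrC ler_pdivrMr// mulrC => /le_trans; apply.
rewrite /M mulrDl lerD2l mulrAC ler_pdivrMr//.
by have := nrm_ge0 x; nra.
Qed.

(** A Lax-Milgram argument: [D] is bounded by [N] and coercive with constant [e], so [nrm (u - k D
    u) ^ 2 <= (1 - 2 k e + k^2 N^2) nrm u ^ 2], and [k = e / N^2] makes the factor
    [1 - e^2 / N^2]. *)
Lemma shifted_square_onto w (e : R) : 0 < e ->
  forall y, exists x, rho (star w * w) x + e%:C%C *: x = y.
Proof.
move=> e0 y; pose D x := rho (star w * w) x + e%:C%C *: x.
have DB x x' : D x - D x' = D (x - x').
  by rewrite /D bopB scalerBr opprD addrACA.
have [M M0 hM] := bop_bounded (rho (star w * w)).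
pose N := M + e; have N0 : 0 < N by rewrite addr_gt0.
have DN x : nrm (D x) <= N * nrm x.
  rewrite (le_trans (nrmD _ _))// nrmZ ger0_norm ?(ltW e0)// /N mulrDl lerD2r.
  exact: hM.
have De x : e * nrm x ^+ 2 <= rip (D x) x.
  by rewrite /D ripDl ripZl rip_starM rip_sq lerDr sqr_ge0.
pose k := e / N ^+ 2; pose q2 := 1 - e ^+ 2 / N ^+ 2.
pose f x := x - k%:C%C *: (D x - y).
have eN : e <= N by rewrite /N lerDr ltW.
have q20 : 0 <= q2.
  by rewrite subr_ge0 ler_pdivrMr ?exprn_gt0// mul1r ler_pXn2r// nnegrE ltW.
have q21 : q2 < 1 by rewrite ltrBlDr ltrDl divr_gt0// exprn_gt0.
have fL x x' : nrm (f x - f x') <= Num.sqrt q2 * nrm (x - x').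
  have -> : f x - f x' = (x - x') - k%:C%C *: D (x - x').
    rewrite /f -DB opprD opprK addrACA; congr (_ + _).
    have -> : D x - D x' = (D x - y) - (D x' - y) by rewrite opprB addrA subrK.
    by rewrite [in RHS]scalerBr opprB addrC.
  move: (x - x') => u; apply: nrm_le; first by rewrite mulr_ge0 ?nrm_ge0 ?sqrtr_ge0.
  rewrite exprMn sqr_sqrtr// !(ripBl, ripBr, ripZl, ripZr) (ripC _ (D _)).
  rewrite !rip_sq; have := De u.
  have : nrm (D u) ^+ 2 <= N ^+ 2 * nrm u ^+ 2.
    by rewrite -exprMn ler_pXn2r ?nnegrE ?mulr_ge0 ?nrm_ge0// ltW.
  have k0 : 0 <= k by rewrite divr_ge0 ?exprn_ge0// ltW.
  have kN : k * N ^+ 2 = e by rewrite /k divfK// gt_eqF// exprn_gt0.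
  have -> : q2 = 1 - k * e by rewrite /q2 /k mulrAC expr2.
  move=> /(ler_wpM2l k0) h1 /(ler_wpM2l k0) h2.
  have := ler_wpM2l k0 h1.
  have -> : k * (k * (N ^+ 2 * nrm u ^+ 2)) = k * (e * nrm u ^+ 2).
    by rewrite -kN; ring.
  by lra.
have [||x _ fx] := @contraction_fixed_point R H setT f (Num.sqrt q2) 0 I
    (fun _ _ => I) _ (fun x x' _ _ => fL x x').
- by rewrite sqrtr_ge0 -sqrtr1 ltr_sqrt.
- by [].
have k0 : k != 0 by rewrite mulf_neq0 ?invr_neq0 ?expf_neq0// gt_eqF.
exists x; rewrite -/(D x); apply/eqP; rewrite -subr_eq0.
have /eqP : k%:C%C *: (D x - y) = 0.
  have : x - k%:C%C *: (D x - y) = x by [].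
  by move/eqP; rewrite subr_eq addrC -subr_eq subrr eq_sym => /eqP.
by rewrite scaler_eq0 => /orP[/eqP[/eqP]|//]; rewrite (negPf k0).
Qed.

End Representation.

(** * Completely positive maps and Schwarz inequalities *)

Section CompletelyPositive.
Context {R : realType} {A : cstarAlgType R} {H : hilbertType R}.

(** The properties of [Phi \o rho] on which the estimates rest. [cp_pos] is complete positivity
    tested on the matrices [star (u i) * u j]; [cp_mono] reflects [star w * w <= nrm w ^+ 2]. *)
Record cp_unital (Psi : A -> bop H) : Prop := {
  cpD : forall a b, Psi (a + b) = Psi a + Psi b;
  cpZ : forall c a, Psi (c *: a) = c *: Psi a;
  cp1 : Psi 1 = 1;
  cp_adj : forall a x y, rip (Psi a x) y = rip x (Psi (star a) y);
  cp_pos : forall n (u : 'I_n -> A) (x : 'I_n -> H),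
    0 <= \sum_i \sum_j rip (Psi (star (u i) * u j) (x j)) (x i);
  cp_mono : forall w u x, rip (Psi (star (w * u) * (w * u)) x) x <=
    nrm w ^+ 2 * rip (Psi (star u * u) x) x
}.

(** Before [Phi] is applied, the form of the matrix at [x] is that of [S] at
    [\sum_j rho (u j) (x j)]. [S = 1] yields [cp_pos], and [S = nrm w ^+ 2 - rho (star w * w)]
    yields [cp_mono]. *)
Lemma ucp_family (rho : A -> bop H) (Phi : bop H -> bop H) n
    (u : 'I_n -> A) (S : bop H) (x : 'I_n -> H) :
  representation rho -> ucp Phi -> (forall y, 0 <= inner (S y) y) ->
  0 <= \sum_i \sum_j
    inner (Phi (rho (star (u i)) * S * rho (u j)) (x j)) (x i).
Proof.
move=> [_ _ adj] [[_ cpP] _] S0; apply: cpP => {}x.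
have Ssum (y : 'I_n -> H) : S (\sum_j y j) = \sum_j S (y j).
  by rewrite (big_morph S (bopD S) (bop0 S)).
have -> : \sum_i \sum_j inner ((rho (star (u i)) * S * rho (u j)) (x j)) (x i) =
    inner (S (\sum_j rho (u j) (x j))) (\sum_i rho (u i) (x i)).
  rewrite linear_sumr; apply: eq_bigr => i _.
  rewrite Ssum linear_sumlz; apply: eq_bigr => j _.
  by rewrite !bop_mulE adj starK.
exact: S0.
Qed.

Lemma ucp_cp_unital (rho : A -> bop H) (Phi : bop H -> bop H) :
  (forall a b : A, a * b = b * a) ->
  representation rho -> ucp Phi -> cp_unital (Phi \o rho).
Proof.
move=> commA rp ucpP; have [[PL _] P1] := ucpP.
have P0 : Phi 0 = 0.
  by have := PL (-1) 0 0; rewrite scaler0 addr0 scaleN1r addNr.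
have PZ c a : Phi (c *: a) = c *: Phi a by rewrite -[c *: a]addr0 PL P0 addr0.
have PD a b : Phi (a + b) = Phi a + Phi b by rewrite -[a]scale1r PL !scale1r.
have fam n (u : 'I_n -> A) (x : 'I_n -> H) :
    0 <= \sum_i \sum_j inner (Phi (rho (star (u i) * u j)) (x j)) (x i).
  have := @ucp_family rho Phi n u 1 x rp ucpP (fun y => _).
  under eq_bigr do under eq_bigr do rewrite mulr1 -(repM rp).
  by apply => y; rewrite bop_1E -norm_inner exprn_ge0.
split => [a b|c a||a x y|n u x|w u x] /=.
- by rewrite (repD rp) PD.
- by rewrite (repZ rp) PZ.
- by rewrite (rep1 rp).
(* The family [(1, a)] at the vectors [(y, v x)] has a real value, and so do its diagonal terms;
   hence the off-diagonal sum is real. Taking [v = 'i] compares real parts. *)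
- have herm (v : R[i]) : complex.Im (v * inner (Phi (rho a) x) y +
      Num.conj v * inner (Phi (rho (star a)) y) x) = 0.
    have /ger0_Im := fam 2 (fun i => if i == 0 then 1 else a)
      (fun i => if i == 0 then y else v *: x).
    have /ger0_Im := fam 1 (fun=> a) (fun=> v *: x).
    have /ger0_Im := fam 1 (fun=> 1) (fun=> y).
    rewrite !big_ord_recl !big_ord0 /= !addr0 !cstar1 !mul1r !mulr1.
    rewrite !bopZ !linearZl_LR !linearZr_LR /= => h1 h2.
    rewrite !raddfD /= h1 h2 add0r addr0 => h3.
    by rewrite h3.
  have iJ : Num.conj ('i%C : R[i]) = - 'i%C.
    by apply/eqP; rewrite eq_complex /= oppr0 !eqxx.
  rewrite (ripC x) /rip; have := herm 'i%C; rewrite iJ mulNr -mulrBr mulrC ImiRe.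
  by rewrite raddfB => /eqP; rewrite subr_eq0 => /eqP.
- have := fam n u x; rewrite lecE => /andP[_]; rewrite raddf_sum /=.
  by under eq_bigr do rewrite raddf_sum.
- pose S : bop H := (nrm w ^+ 2)%:C%C *: (1 : bop H) - rho (star w * w).
  have S0 y : 0 <= inner (S y) y.
    rewrite bop_subE bop_scaleE bop_1E linearBl linearZl_LR /= -norm_inner.
    have [_ _ adj] := rp; rewrite (repM_apply rp) adj starK -norm_inner.
    rewrite !nrmE -!rmorphXn -rmorphM -rmorphB ler0c /= subr_ge0 -exprMn.
    by rewrite ler_pXn2r ?nnegrE ?mulr_ge0 ?nrm_ge0// (rep_contractive rp commA).
  have := @ucp_family rho Phi 1 (fun=> u) S (fun=> x) rp ucpP S0.
  rewrite !big_ord_recl !big_ord0 /= !addr0.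
  have -> : rho (star u) * S * rho u =
      (nrm w ^+ 2)%:C%C *: rho (star u * u) - rho (star (w * u) * (w * u)).
    rewrite cstarM !(repM rp) /S mulrBr mulrBl (repM rp) !mulrA; congr (_ - _).
    apply: val_inj; apply/funext => y.
    exact: bopZ.
  have -> (B C : bop H) : Phi (B - C) = Phi B - Phi C.
    by rewrite -scaleN1r PD PZ scaleN1r.
  rewrite PZ bop_subE bop_scaleE lecE => /andP[_].
  by rewrite -/(rip _ _) ripBl ripZl raddf0 subr_ge0.
Qed.

(** The case [Phi = id], through which bounds for completely positive maps apply to [rho] as
    well. *)
Lemma rep_cp_unital (rho : A -> bop H) :
  (forall a b : A, a * b = b * a) -> representation rho -> cp_unital rho.
Proof. by move=> commA rp; apply: (@ucp_cp_unital rho (fun S => S) commA rp); split. Qed.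

Section Consequences.
Variable Psi : A -> bop H.
Hypothesis cpP : cp_unital Psi.

Lemma cpN a : Psi (- a) = - Psi a.
Proof. by rewrite -scaleN1r (cpZ cpP) scaleN1r. Qed.

Lemma cpB a b : Psi (a - b) = Psi a - Psi b.
Proof. by rewrite (cpD cpP) cpN. Qed.

Lemma cp_adj' a x y : rip (Psi (star a) x) y = rip x (Psi a y).
Proof. by rewrite (cp_adj cpP) starK. Qed.

Lemma cp_pos2 (a b : A) x y (s : R) :
  0 <= rip (Psi (star a * a) x) x * s ^+ 2
       + 2 * rip (Psi (star a * b) y) x * s + rip (Psi (star b * b) y) y.
Proof.
have := cp_pos cpP (fun i : 'I_2 => if i == 0 then a else b)
  (fun i => if i == 0 then s%:C%C *: x else y).
rewrite !big_ord_recl !big_ord0 /= !addr0.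
rewrite -[star b * a](starK) cstarM starK cp_adj'.
by rewrite !bopZ !(ripZl, ripZr) (ripC _ (Psi (star a * b) y)); lra.
Qed.

Lemma cp_ge0 a x : 0 <= rip (Psi (star a * a) x) x.
Proof. by have := cp_pos2 a a 0 x 0; rewrite !rip0r !mulr0 mul0r !add0r. Qed.

Lemma cp_CS (a b : A) x y :
  rip (Psi (star a * b) y) x ^+ 2 <=
  rip (Psi (star a * a) x) x * rip (Psi (star b * b) y) y.
Proof. by apply: discriminant_le => s; exact: cp_pos2. Qed.

(** Positivity on the family [(star z, a, b)] at [(s o, x, - y)], with [o] the difference on the
    left, is a quadratic polynomial in [s] with linear coefficient [2 nrm o ^ 2] and leading
    coefficient at most [nrm z ^ 2 nrm o ^ 2]; its discriminant gives the bound. *)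
Lemma cp_schwarz (z a b : A) x y :
  nrm (Psi (z * a) x - Psi (z * b) y) ^+ 2 <=
  nrm z ^+ 2 * (rip (Psi (star a * a) x) x - 2 * rip (Psi (star a * b) y) x
                + rip (Psi (star b * b) y) y).
Proof.
set E := _ - _ + _; set o := _ - _.
have pos s : 0 <= rip (Psi (z * star z) o) o * s ^+ 2 + 2 * nrm o ^+ 2 * s + E.
  have := cp_pos cpP
    (fun i : 'I_3 => if i == 0 then star z else if i == 1 then a else b)
    (fun i => if i == 0 then s%:C%C *: o else if i == 1 then x else - y).
  rewrite !big_ord_recl !big_ord0 /= !addr0 !starK.
  rewrite -[star b * a](starK) cstarM starK cp_adj'.
  rewrite -[star a * star z](starK) cstarM !starK cp_adj'.
  rewrite -[star b * star z](starK) cstarM !starK cp_adj'.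
  rewrite !bopZ !bopN !(ripZl, ripZr, ripNl, ripNr, opprK).
  have := rip_sq o; rewrite {1}/o ripBl => oE.
  rewrite /E !(ripC o) (ripC x (Psi (star a * b) y)). rewrite -oE; lra.
have E0 : 0 <= E by have := pos 0; rewrite expr0n /=; lra.
have q : rip (Psi (z * star z) o) o <= nrm z ^+ 2 * nrm o ^+ 2.
  have := cp_mono cpP (star z) 1 o.
  by rewrite !mulr1 starK cstar1 (cp1 cpP) nrm_star rip_sq.
have := discriminant_le pos; have := sqr_ge0 (nrm o); have := sqr_ge0 (nrm z).
move: (nrm o ^+ 2) (nrm z ^+ 2) q => N M q M0 N0 h.
have [->|N1] := eqVneq N 0; first by rewrite mulr_ge0.
have {}N1 : 0 < N by rewrite lt_def N1.
rewrite -(ler_pM2r N1) -expr2 (le_trans h)//.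
by rewrite mulrAC ler_wpM2r.
Qed.

Lemma cp_contractive a x : nrm (Psi a x) <= nrm a * nrm x.
Proof.
have := cp_schwarz a 1 0 x 0.
rewrite !mulr1 !bop0 subr0 cstar1 (cp1 cpP) rip_sq !rip0l.
rewrite nrm0 expr0n bop_1E rip_sq mulr0 subr0 addr0 -exprMn.
by rewrite ler_pXn2r ?nnegrE ?mulr_ge0 ?nrm_ge0.
Qed.

End Consequences.
End CompletelyPositive.

(** * A spectral radius bound between quadratic forms *)

Lemma le_of_pow2 (R : realType) (a b m C : R) : 0 < m -> 0 <= b -> 0 <= C ->
  (forall n, a ^+ (2 ^ n) * m <= b ^+ (2 ^ n) * C) -> a <= b.
Proof.
move=> m0 b0 C0 h; rewrite leNgt; apply/negP => ba.
have a0 : 0 < a by exact: le_lt_trans b0 ba.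
(* If [b < a], then [C * (b / a) ^+ n] falls below [m] from some [N] on, in particular at
   [2 ^ N >= N]. *)
have [|N hN] := @geometric_small R C (b / a) m C0 _ m0.
  by rewrite divr_ge0 ?(ltW a0)//= ltr_pdivrMr// mul1r.
have := hN (2 ^ N)%N (ltnW (ltn_expl _ (ltnSn 1))).
rewrite expr_div_n mulrA ltr_pdivrMr ?exprn_gt0// ltNge.
by rewrite (mulrC m) (mulrC C) h.
Qed.

Section SpectralRadius.
Context {R : realType} {H : hilbertType R}.
Variables (P D K : bop H) (mu : R).
Hypotheses (P_sym : forall x y, rip (P x) y = rip x (P y))
  (D_sym : forall x y, rip (D x) y = rip x (D y))
  (K_sym : forall x y, rip (K x) y = rip x (K y))
  (PD : P * D = D * P)
  (P_ge0 : forall x, 0 <= rip (P x) x)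
  (PD_ge0 : forall x, 0 <= rip (P (D x)) x)
  (D_onto : forall y, exists x, D x = y)
  (PD_onto : forall y, exists x, P (D x) = y)
  (mu_ge0 : 0 <= mu)
  (K_le : forall x y,
     rip (K x) y ^+ 2 <= mu ^+ 2 * (rip (P x) x * rip (P (D (D y))) y)).

Lemma form_CS (Q : bop H) : (forall x y, rip (Q x) y = rip x (Q y)) ->
  (forall x, 0 <= rip (Q x) x) ->
  forall x y, rip (Q x) y ^+ 2 <= rip (Q x) x * rip (Q y) y.
Proof.
move=> Qs Q0 x y; apply: discriminant_le => s; have := Q0 (s%:C%C *: x + y).
rewrite bopD bopZ !(ripDl, ripDr, ripZl, ripZr) (Qs y x) (ripC y).
by lra.
Qed.

(* [T = (P D)^-1 K] is a contraction up to [mu] for the form of [P] and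
   symmetric for the form of [P D], so its numerical range for the latter is
   controlled by its spectral radius. *)
Lemma spectral_radius_le x : rip (K x) x <= mu * rip (P (D x)) x.
Proof.
have PDC y : P (D y) = D (P y) by rewrite -!bop_mulE PD.
have PD_sym y z : rip (P (D y)) z = rip y (P (D z)).
  by rewrite P_sym D_sym PDC.
pose T y := projT1 (cid (PD_onto (K y))).
have TE y : P (D (T y)) = K y by rewrite /T; case: cid.
(* [K_le] is tested at the [z] with [D z = T y]: then [rip (P (T y)) (T y)] appears squared on the
   left and once on the right, and cancels. *)
have T_le y : rip (P (T y)) (T y) <= mu ^+ 2 * rip (P y) y.
  have [z zE] := D_onto (T y); have := K_le y z.
  rewrite -TE PDC D_sym zE PDC D_sym zE.
  have := P_ge0 (T y); have := P_ge0 y.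
  move: (rip (P (T y)) (T y)) (rip (P y) y) => N M M0 N0 h.
  have [->|N1] := eqVneq N 0; first by rewrite mulr_ge0// exprn_ge0.
  have {}N1 : 0 < N by rewrite lt_def N1.
  by rewrite -(ler_pM2r N1) -expr2 -mulrA.
have TnK n : rip (P (iter n T x)) (iter n T x) <= mu ^+ (2 * n) * rip (P x) x.
  elim: n => [|n ih]; first by rewrite mul1r.
  rewrite (le_trans (T_le _))// mulnS exprD -mulrA.
  by rewrite ler_wpM2l// exprn_ge0.
(* The moments of [T] at [x] in the form of [P D]; symmetry of [T] splits [m (n + k)] between the
   two arguments. *)
pose m n := rip (P (D (iter n T x))) x.
have shift n k : m (n + k)%N = rip (P (D (iter n T x))) (iter k T x).
  elim: k n => [|k ih] n; first by rewrite addn0.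
  by rewrite -addSnnS ih /= TE K_sym -TE PD_sym.
have m0 : 0 <= m 0 by exact: PD_ge0.
have sq n : m n ^+ 2 <= m (n + n)%N * m 0.
  by rewrite shift; apply: (@form_CS (P * D) PD_sym PD_ge0).
have -> : rip (K x) x = m 1%N by rewrite /m /= TE.
rewrite -[rip (P (D x)) x]/(m 0%N).
have [m1|m1] := leP (m 1%N) 0; first by rewrite (le_trans m1)// mulr_ge0.
have {}m0 : 0 < m 0%N.
  by rewrite lt_def m0 andbT; apply/eqP => m00; have := sq 1%N; rewrite m00; nra.
(* [sq] is iterated along [n = 1, 2, 4, ...]. *)
have pw n : m 1%N ^+ (2 ^ n) * m 0%N <= m (2 ^ n)%N * m 0%N ^+ (2 ^ n).
  elim: n => [|n ih]; first by rewrite expr1.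
  rewrite expnS mul2n -addnn !exprD -(ler_pM2r m0).
  have lhs0 : 0 <= m 1%N ^+ (2 ^ n) * m 0%N by rewrite mulr_ge0 ?exprn_ge0// ltW.
  have p0 : 0 <= m 0%N ^+ (2 ^ n) by rewrite exprn_ge0// ltW.
  have := sq (2 ^ n)%N; have := ler_pM lhs0 lhs0 ih ih.
  move: (m (2 ^ n)%N) (m (2 ^ n + 2 ^ n)%N) (m 0%N ^+ _) p0 (m 1%N ^+ _).
  move=> u v w w0 z h1 h2; have := ler_wpM2r (mulr_ge0 w0 w0) h2; nra.
pose a := rip (P x) x; pose b := rip (P (D x)) (D x).
have ab0 : 0 <= a * b by rewrite mulr_ge0 ?P_ge0.
(* [a * b + 1] dominates the square root of [a * b] produced by the Cauchy-Schwarz inequality for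
   [P]. *)
have mN n : m n <= mu ^+ n * (a * b + 1).
  have : m n ^+ 2 <= (mu ^+ n * (a * b + 1)) ^+ 2.
    have -> : m n = rip (P (iter n T x)) (D x) by rewrite /m PDC D_sym.
    apply: le_trans (form_CS P_sym P_ge0 _ _) _; rewrite -/b.
    rewrite exprMn -exprM muln2 -mul2n.
    apply: le_trans (ler_wpM2r (P_ge0 _) (TnK n)) _.
    rewrite -/a -mulrA ler_wpM2l ?exprn_ge0//; nra.
  have r0 : 0 <= mu ^+ n * (a * b + 1) by rewrite mulr_ge0 ?exprn_ge0// addr_ge0.
  have [mn0|mn0] := leP (m n) 0; first by rewrite (le_trans mn0).
  by rewrite ler_pXn2r// nnegrE// ltW.
apply: (@le_of_pow2 _ _ _ (m 0%N) (a * b + 1)) => //.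
- by rewrite mulr_ge0// ltW.
- by rewrite addr_ge0.
move=> n; rewrite (le_trans (pw n))// exprMn mulrAC.
by rewrite ler_wpM2r ?exprn_ge0 ?(ltW m0)// mN.
Qed.

End SpectralRadius.

(* A discrete maximum principle: the first maximal term of a log-convex
   sequence lies at an end. *)
Lemma log_convex_le1 (R : realFieldType) (r : nat) (u : nat -> R) :
  (forall j, 0 <= u j) -> u 0%N <= 1 -> u r <= 1 ->
  (forall j, (j.+1 < r)%N -> u j.+1 ^+ 2 <= u j * u j.+2) ->
  forall j, (j <= r)%N -> u j <= 1.
Proof.
move=> u0 u01 ur1 cvx j jr.
pose isMax i := (i <= r)%N && [forall k : 'I_r.+1, u k <= u i].
have exMax : exists i, isMax i.
  have [i _ imax] := @arg_maxP _ _ _ (@ord0 r) xpredT (fun k : 'I_r.+1 => u k) isT.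
  by exists i; rewrite /isMax -ltnS ltn_ord /=; apply/forallP => k; exact: imax.
case: (ex_minnP exMax) => i /andP[ir /forallP imax] imin.
have ji : u j <= u i by exact: (imax (Ordinal (jr : (j < r.+1)%N))).
apply: (le_trans ji); rewrite leNgt; apply/negP => i1.
have i0 : (0 < i)%N by case: (i) i1 => // /lt_le_trans/(_ u01); rewrite ltxx.
have ir' : (i < r)%N.
  by rewrite ltn_neqAle ir andbT; apply: contraTneq i1 => ->; rewrite -leNgt.
case: i i0 ir ir' imax imin ji i1 => // i _ _ ir imax imin _ i1.
have le2 : u i.+2 <= u i.+1 by exact: (imax (Ordinal (ir : (i.+2 < r.+1)%N))).
have lt0 : u i < u i.+1.
  rewrite ltNge; apply/negP => h; have : isMax i.
    rewrite /isMax (leq_trans (leqnSn i) (ltnW ir)) /=.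
    by apply/forallP => k; exact: le_trans (imax k) h.
  by move=> /imin; rewrite ltnn.
have := cvx i ir; have := u0 i; have := u0 i.+2; nra.
Qed.

(** * Monomials in [t] and [star t] *)

Section Monomials.
Context {R : realType} {A : cstarAlgType R}.
Hypothesis commA : forall a b : A, a * b = b * a.
Variable t : A.

(** By commutativity [monom n n] is the power [c ^+ n] of [c = star t * t], so powers of [c] and
    elements of [G] share one product rule. *)
Definition monom m n : A := star t ^+ m * t ^+ n.

Lemma monomM m n m' n' : monom m n * monom m' n' = monom (m + m') (n + n').
Proof.
by rewrite /monom !exprD -!mulrA; congr (_ * _); rewrite !mulrA (commA (t ^+ n)).
Qed.

Lemma monom_star m n : star (monom m n) = monom n m.
Proof. by rewrite /monom cstarM !cstarX starK commA commA. Qed.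

Lemma monom0 : monom 0 0 = 1.
Proof. by rewrite /monom !expr0 mulr1. Qed.

Lemma monom_sq m n : star (monom m n) * monom m n = monom (m + n) (m + n).
Proof. by rewrite monom_star monomM addnC. Qed.

End Monomials.

(** * Log-convexity of the moment constants *)

Section Moments.
Context {R : realType} {A : cstarAlgType R} {H : hilbertType R}.
Hypothesis commA : forall a b : A, a * b = b * a.
Variables (rho Psi : A -> bop H) (t : A) (e : R).
Hypotheses (rp : representation rho) (cpP : cp_unital Psi) (e0 : 0 < e).

Let D : A := monom t 1 1 + e%:C%C *: (1 : A).

Lemma rep_shift x : rho D x = rho (monom t 1 1) x + e%:C%C *: x.
Proof. by rewrite /D (repD rp) (repZ rp) (rep1 rp). Qed.

Lemma shift_onto n y : exists x, rho (D ^+ n) x = y.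
Proof.
elim: n y => [|n ih] y; first by exists y; rewrite expr0 (rep1 rp).
have [z zE] := ih y; have [x xE] := shifted_square_onto rp (monom t 0 1) e0 z.
exists x; rewrite exprSr (repM_apply rp) rep_shift -zE -xE.
by rewrite monom_sq.
Qed.

Lemma star_shiftX n : star (D ^+ n) = D ^+ n.
Proof.
by rewrite cstarX /D starD starZ conj_realC cstar1 monom_star.
Qed.

Lemma shift_sym n x y : rip (rho (D ^+ n) x) y = rip x (rho (D ^+ n) y).
Proof. by rewrite (rep_adj rp) star_shiftX. Qed.

(** Induction in steps of two: the form of [D ^+ n.+2] at [x] is that of [D ^+ n] at [rho D x], and
    [e * nrm x <= nrm (rho D x)]. *)
Lemma shift_ge n x : e ^+ n * nrm x ^+ 2 <= rip (rho (D ^+ n) x) x.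
Proof.
have D1 y : e * nrm y ^+ 2 <= rip (rho D y) y.
  rewrite rep_shift ripDl ripZl rip_sq lerDr -[monom t 1 1](monom_sq commA t 0 1).
  by rewrite (rip_starM rp) sqr_ge0.
have [k] : exists k, (n < k)%N by exists n.+1.
elim: k n x => // k ih [|[|n]] x nk.
- by rewrite !expr0 (rep1 rp) mul1r rip_sq.
- by rewrite !expr1.
have -> : D ^+ n.+2 = D ^+ 1 * (D ^+ n * D) by rewrite expr1 -exprSr exprS.
rewrite !(repM_apply rp) shift_sym expr1.
apply: le_trans (ih n (rho D x) _); last by rewrite -ltnS ltnW.
rewrite -addn2 exprD -mulrA ler_wpM2l ?exprn_ge0 ?(ltW e0)// -exprMn.
rewrite ler_pXn2r ?nnegrE ?mulr_ge0 ?nrm_ge0 ?(ltW e0)//.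
have := le_trans (D1 x) (rip_CS _ _); have := nrm_ge0 x; have := nrm_ge0 (rho D x).
move: (nrm x) (nrm (rho D x)) => M N N0 M0 h.
have [->|M1] := eqVneq M 0; first by rewrite mulr0.
by rewrite -(@ler_pM2r _ M) ?lt_def ?M1// -mulrA -expr2.
Qed.

(** The admissible constants; the infimum is the [M_j] of the sketch. *)
Let ratios j : set R := [set m | 0 <= m /\
  forall x, rip (Psi (monom t j j) x) x <= m * rip (rho (D ^+ j) x) x].

(** The lower bound [e ^+ j] for [D ^+ j] makes the set nonempty. The infimum is attained because
    each vector imposes a closed condition on the constant. *)
Lemma ratios_inf j : ratios j (inf (ratios j)).
Proof.
have ne : ratios j !=set0.
  exists (nrm (monom t j j) / e ^+ j); split.
    by rewrite divr_ge0 ?nrm_ge0 ?exprn_ge0// ltW.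
  move=> x; rewrite (le_trans (rip_CS _ _))// mulrAC ler_pdivlMr ?exprn_gt0//.
  apply: le_trans (ler_wpM2l (nrm_ge0 _) (shift_ge j x)).
  rewrite (mulrC (e ^+ j)) expr2 !mulrA !ler_wpM2r ?nrm_ge0 ?exprn_ge0 ?(ltW e0)//.
  exact: cp_contractive.
split; first by apply: lb_le_inf => // m [].
move=> x; have := shift_ge j x; have [x0|x0] := eqVneq (nrm x) 0.
  by rewrite (nrm_eq0 x0) !rip0r mulr0.
move=> /(lt_le_trans _) dx; have {}dx : 0 < rip (rho (D ^+ j) x) x.
  by apply: dx; rewrite mulr_gt0 ?exprn_gt0// lt_def x0 nrm_ge0.
rewrite -ler_pdivrMr//; apply: lb_le_inf => // m [_ /(_ x)].
by rewrite ler_pdivrMr.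
Qed.

Lemma moment_le r : 
  (forall x, rip (Psi (monom t r r) x) x <= rip (rho (D ^+ r) x) x) ->
  forall j, (j <= r)%N ->
  forall x, rip (Psi (monom t j j) x) x <= rip (rho (D ^+ j) x) x.
Proof.
move=> hr j jr x; have rat0 i : 0 <= inf (ratios i) by case: (ratios_inf i).
have lb i : has_lbound (ratios i) by exists 0 => m [].
have rat_le1 i : (forall x, rip (Psi (monom t i i) x) x <= rip (rho (D ^+ i) x) x) ->
    inf (ratios i) <= 1.
  by move=> h; apply: ge_inf => //; split=> // y; rewrite mul1r.
have Dge0 i y : 0 <= rip (rho (D ^+ i) y) y.
  by apply: le_trans (shift_ge i y); rewrite mulr_ge0 ?exprn_ge0 ?nrm_ge0 ?(ltW e0).
have : inf (ratios j) <= 1.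
  apply: (@log_convex_le1 R r (fun i => inf (ratios i))) => // [||i ir].
  - by apply: rat_le1 => y; rewrite monom0 expr0 (cp1 cpP) (rep1 rp).
  - exact: rat_le1.
  have [M0 hM] := ratios_inf i; have [M2 hM2] := ratios_inf i.+2.
  set M := inf (ratios i) in M0 hM *; set M' := inf (ratios i.+2) in M2 hM2 *.
  have MM : 0 <= M * M' by rewrite mulr_ge0.
  (* It suffices that the geometric mean of the two outer constants is admissible for [i.+1]. *)
  rewrite -(sqr_sqrtr MM) ler_pXn2r ?nnegrE ?sqrtr_ge0//; apply: ge_inf => //.
  split=> [|y]; first exact: sqrtr_ge0.
  rewrite exprSr (repM_apply rp).
  apply: (@spectral_radius_le R H (rho (D ^+ i)) (rho D) (Psi (monom t i.+1 i.+1))).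
  - exact: shift_sym.
  - by rewrite -[D]expr1; exact: shift_sym.
  - by move=> u v; rewrite (cp_adj cpP) monom_star.
  - by rewrite -!(repM rp) commA.
  - exact: Dge0.
  - by move=> u; rewrite -(repM_apply rp) -exprSr.
  - by move=> u; rewrite -[D]expr1; exact: shift_onto.
  - move=> u; have [v vE] := shift_onto i.+1 u; exists v.
    by rewrite -(repM_apply rp) -exprSr.
  - exact: sqrtr_ge0.
  move=> u v; rewrite sqr_sqrtr//.
  (* [c ^+ i.+1] is [star a * b] for [a = star t * t ^+ i.+1] and [b = t ^+ i], with
     [star a * a = c ^+ i.+2] and [star b * b = c ^+ i]. *)
  have := cp_CS cpP (monom t 1 i.+1) (monom t 0 i) v u.
  have g1 := cp_ge0 cpP (monom t 1 i.+1) v; have g0 := cp_ge0 cpP (monom t 0 i) u.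
  rewrite !monom_sq// monom_star// monomM// addn0 add1n in g1 g0 * => /le_trans.
  apply; rewrite mulrC mulrACA ler_pM//; apply: le_trans (hM2 v) _.
  by rewrite !exprSr !(repM_apply rp).
move=> le1; have [_ /(_ x) h] := ratios_inf j; apply: le_trans h _.
by rewrite ler_piMl.
Qed.

End Moments.

(** * Powers of [c + e] compared with powers of [c] *)

Section Shift.
Context {R : realType} {A : cstarAlgType R} {H : hilbertType R}.
Hypothesis commA : forall a b : A, a * b = b * a.
Variables (rho : A -> bop H) (t : A).
Hypothesis rp : representation rho.
Let c := monom t 1 1.
Let D (e : R) : A := c + e%:C%C *: (1 : A).

Lemma rep_monom_ge0 j x : 0 <= rip (rho (monom t j j) x) x.
Proof. by rewrite -[monom t j j](monom_sq commA t 0 j) (rip_starM rp) sqr_ge0. Qed.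

Lemma shift_expansion (e : R) j x : 0 < e ->
  rip (rho (monom t j j) (rho (D e) x)) (rho (D e) x) =
  rip (rho (monom t j.+2 j.+2) x) x + 2 * e * rip (rho (monom t j.+1 j.+1) x) x
  + e ^+ 2 * rip (rho (monom t j j) x) x.
Proof.
move=> e0; rewrite !(rep_shift _ _ rp) !(bopD, bopZ, ripDl, ripDr, ripZl, ripZr).
have cs y : rip y (rho c x) = rip (rho c y) x by rewrite (rep_adj rp) monom_star.
by rewrite !cs -!(repM_apply rp) !monomM// !(add1n, addn1); ring.
Qed.

(** The gap [e ^+ r.+1] absorbs the error in an asymptotic bound for [Psi (c ^+ r.+1)], as
    [moment_le] requires. The exponent is positive since [D e ^+ 0 = 1] leaves no gap. *)
Lemma shift_pow_gt (e : R) r x : 0 < e ->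
  rip (rho (monom t r.+1 r.+1) x) x + e ^+ r.+1 * nrm x ^+ 2
  <= rip (rho (D e ^+ r.+1) x) x.
Proof.
move=> e0; have De y : e * nrm y <= nrm (rho (D e) y).
  have h : e ^+ 2 * nrm y ^+ 2 <= nrm (rho (D e) y) ^+ 2.
    have := shift_expansion 0 y e0; rewrite monom0 (rep1 rp) !bop_1E !rip_sq => ->.
    have := rep_monom_ge0 1 y; have := rep_monom_ge0 2 y.
    by move=> h2 h1; rewrite lerDr addr_ge0// !mulr_ge0// ltW.
  by rewrite -exprMn ler_pXn2r ?nnegrE ?mulr_ge0 ?nrm_ge0 ?(ltW e0) in h.
have DD n y : rip (rho (D e ^+ n.+2) y) y =
    rip (rho (D e ^+ n) (rho (D e) y)) (rho (D e) y).
  have -> : D e ^+ n.+2 = D e ^+ 1 * (D e ^+ n * D e).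
    by rewrite expr1 -exprSr exprS.
  by rewrite !(repM_apply rp) (shift_sym commA _ _ rp) expr1.
have [k] : exists k, (r < k)%N by exists r.+1.
elim: k r x => // k ih [|[|r]] x rk.
- by rewrite !expr1 (rep_shift _ _ rp) ripDl ripZl rip_sq.
- rewrite DD expr0 (rep1 rp) bop_1E rip_sq.
  have := shift_expansion 0 x e0; rewrite monom0 (rep1 rp) !bop_1E !rip_sq => ->.
  by rewrite lerD2r lerDl !mulr_ge0 ?(ltW e0)// rep_monom_ge0.
rewrite DD; apply: le_trans (ih r (rho (D e) x) _); last by rewrite -ltnS ltnW.
rewrite shift_expansion// -!addrA lerD2l.
apply: le_trans (_ : e ^+ r.+1 * nrm (rho (D e) x) ^+ 2 <= _); last first.
  by rewrite addrA lerDr addr_ge0// !mulr_ge0 ?exprn_ge0 ?(ltW e0)// rep_monom_ge0.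
rewrite -addn2 exprD -mulrA ler_wpM2l ?exprn_ge0 ?(ltW e0)// -exprMn.
by rewrite ler_pXn2r ?nnegrE ?mulr_ge0 ?nrm_ge0 ?(ltW e0).
Qed.

(** [C] is uniform in [e <= 1], so that the shift can be removed after [moment_le] has been
    applied. *)
Lemma shift_pow_near j : exists2 C : R, 0 <= C &
  forall e, 0 < e <= 1 -> nrm (D e ^+ j - monom t j j) <= e * C.
Proof.
elim: j => [|j [C C0 hC]].
  by exists 0 => // e _; rewrite monom0 expr0 subrr nrm0 mulr0.
pose N := nrm c + nrm (1 : A).
exists (N * C + nrm (1 : A) * nrm (monom t j j)) => [|e /andP[e0 e1]].
  by rewrite addr_ge0 ?mulr_ge0 ?addr_ge0 ?nrm_ge0.
have nD : nrm (D e) <= N.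
  rewrite (le_trans (nrmD _ _))// lerD2l nrmZ ger0_norm ?(ltW e0)//.
  by rewrite ler_piMl ?nrm_ge0.
have -> : D e ^+ j.+1 - monom t j.+1 j.+1 =
    D e * (D e ^+ j - monom t j j) + (e%:C%C *: (1 : A)) * monom t j j.
  have -> : monom t j.+1 j.+1 = c * monom t j j by rewrite monomM.
  by rewrite mulrBr -exprS -addrA [in RHS]/D mulrDl opprD -addrA addNr addr0.
have := hC e; rewrite e0 e1 => /(_ isT) h.
rewrite (le_trans (nrmD _ _))// [leRHS]mulrDr lerD//.
  rewrite (le_trans (nrmM _ _))// mulrCA.
  by rewrite ler_pM ?nrm_ge0.
by rewrite (le_trans (nrmM _ _))// nrmZ ger0_norm ?(ltW e0)// mulrA.
Qed.

End Shift.

(** * Convergence to zero in operator norm *)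

Section Vanishing.
Context {R : realType} {H : hilbertType R}.
Implicit Types X Y Z : nat -> bop H.

(** Norm convergence expressed on vectors, so that suprema occur only in [vanishing_opnorm]. *)
Definition vanishing X := forall e : R, 0 < e ->
  \forall k \near \oo, forall x, nrm (X k x) <= e * nrm x.

Lemma vanishing0 : vanishing (fun=> 0).
Proof.
move=> e e0; apply: nearW => k x; rewrite bop_0E nrm0.
by rewrite mulr_ge0 ?nrm_ge0 ?ltW.
Qed.

Lemma vanishing_sum X Y Z : vanishing X -> vanishing Y ->
  (forall k x, nrm (Z k x) <= nrm (X k x) + nrm (Y k x)) -> vanishing Z.
Proof.
move=> vX vY hZ e e0; have e2 : 0 < e / 2 by rewrite divr_gt0.
have := vX _ e2; have := vY _ e2; apply: filterS2 => k hY hX x.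
by rewrite (le_trans (hZ k x))// [e]splitr mulrDl lerD.
Qed.

Lemma vanishingD X Y : vanishing X -> vanishing Y ->
  vanishing (fun k => X k + Y k).
Proof. by move=> vX vY; apply: (vanishing_sum vX vY) => k x; exact: nrmD. Qed.

Lemma vanishing_mulr X (T : bop H) : vanishing X -> vanishing (fun k => X k * T).
Proof.
move=> vX e e0; have [M M0 hM] := bop_bounded T.
have := vX _ (divr_gt0 e0 M0); apply: filterS => k h x.
rewrite bop_mulE (le_trans (h _))// mulrAC ler_pdivrMr// -mulrA.
by rewrite ler_wpM2l ?(ltW e0)// mulrC hM.
Qed.

Lemma vanishing_scale X (c : R[i]) : vanishing X -> vanishing (fun k => c *: X k).
Proof.
move=> vX e e0; pose m := complex.Re `|c| + 1.
have m0 : 0 < m by rewrite ltr_wpDl// -ler0c RRe_real// normr_real.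
have := vX _ (divr_gt0 e0 m0); apply: filterS => k h x.
rewrite bop_scaleE nrmZC; apply: le_trans (_ : m * nrm (X k x) <= _).
  by rewrite ler_wpM2r ?nrm_ge0// lerDl.
by rewrite mulrC -ler_pdivlMr// mulrAC.
Qed.

Lemma vanishing_opnorm X :
  ((fun k => opnorm (X k)) @ \oo --> (0 : R)) <-> vanishing X.
Proof.
have ub k : has_ubound [set complex.Re `|X k x| | x in [set x : H | `|x| <= 1]].
  have [M M0 hM] := bop_bounded (X k); exists M => _ [x /= x1 <-].
  rewrite -/(nrm _) (le_trans (hM x))// ler_piMr ?(ltW M0)//.
  by rewrite -lecR -nrmE.
have mem0 k : [set complex.Re `|X k x| | x in [set x : H | `|x| <= 1]] 0.
  by exists 0; rewrite /= ?normr0 ?ler01// bop0 normr0.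
have op0 k : 0 <= opnorm (X k) by apply: ub_le_sup.
have opE k x : nrm (X k x) <= opnorm (X k) * nrm x.
  have [x0|x0] := eqVneq (nrm x) 0; first by rewrite (nrm_eq0 x0) bop0 nrm0 mulr0.
  have {}x0 : 0 < nrm x by rewrite lt_def x0 nrm_ge0.
  rewrite -ler_pdivrMr// mulrC; apply: ub_le_sup => //.
  exists ((nrm x)^-1%:C%C *: x).
    by rewrite /= nrmE nrmZ ger0_norm ?invr_ge0 ?(ltW x0)// mulVf ?gt_eqF.
  by rewrite -/(nrm _) bopZ nrmZ ger0_norm// invr_ge0 ltW.
split=> [/cvgrPdist_le h e /h|h].
  apply: filterS => k; rewrite sub0r normrN ger0_norm// => hk x.
  by rewrite (le_trans (opE k x))// ler_wpM2r ?nrm_ge0.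
apply/cvgrPdist_le => e e0; have := h e e0; apply: filterS => k hk.
rewrite sub0r normrN ger0_norm//; apply: ge_sup; first by exists 0.
move=> _ [x /= x1 <-]; rewrite -/(nrm _) (le_trans (hk x))//.
by rewrite ler_piMr ?(ltW e0)// -lecR -nrmE.
Qed.

Definition asymp X Y := vanishing (fun k => X k - Y k).

Lemma asymp_refl X : asymp X X.
Proof.
rewrite /asymp; under [X in vanishing X]eq_fun do rewrite subrr.
exact: vanishing0.
Qed.

Lemma asymp_sym X Y : asymp X Y -> asymp Y X.
Proof.
move=> v e e0; have := v e e0; apply: filterS => k h x.
by rewrite -opprB nrmN h.
Qed.

Lemma asymp_trans Y X Z : asymp X Y -> asymp Y Z -> asymp X Z.
Proof.
move=> XY YZ; apply: (vanishing_sum XY YZ) => k x.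
by rewrite (le_trans _ (nrmD _ _))// !bop_subE addrA subrK.
Qed.

Lemma asymp_mulr X Y (T : bop H) : asymp X Y ->
  asymp (fun k => X k * T) (fun k => Y k * T).
Proof.
move=> /(vanishing_mulr T) v e /v; apply: filterS => k h x.
by rewrite -mulrBl h.
Qed.

End Vanishing.

(** * Asymptotic recovery, exchange and cancellation *)

Section Asymptotics.
Context {R : realType} {A : cstarAlgType R} {H : hilbertType R}.
Hypothesis commA : forall a b : A, a * b = b * a.
Variables (rho : A -> bop H) (Psi : nat -> A -> bop H).
Hypotheses (rp : representation rho) (cpP : forall k, cp_unital (Psi k)).

Definition recovered a := asymp (fun k => Psi k a) (fun=> rho a).

(** The one-sided version on quadratic forms; for [star a * a] it is what the Schwarz inequality
    consumes. *)
Definition upper_recovered a := forall e : R, 0 < e ->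
  \forall k \near \oo, forall x,
    rip (Psi k a x) x <= rip (rho a x) x + e * nrm x ^+ 2.

Lemma recovered1 : recovered 1.
Proof.
move=> e e0; apply: nearW => k x; rewrite (cp1 (cpP k)) (rep1 rp) subrr.
by rewrite bop_0E nrm0 mulr_ge0 ?nrm_ge0 ?ltW.
Qed.

Lemma recovered_upper a : recovered a -> upper_recovered a.
Proof.
move=> ra e /ra; apply: filterS => k h x.
rewrite -lerBlDl -ripBl (le_trans (rip_CS _ _))// expr2 mulrA.
by rewrite ler_wpM2r ?nrm_ge0// h.
Qed.

Lemma recovered_star a : recovered a -> recovered (star a).
Proof.
move=> ra e e0; have := ra e e0; apply: filterS => k h x.
set y := (Psi k (star a) - rho (star a)) x.
have : nrm y * nrm y <= e * nrm x * nrm y.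
  rewrite -expr2 -rip_sq {1}/y bop_subE ripBl (cp_adj' (cpP k)) (rep_adj' rp).
  rewrite -ripBr (le_trans (rip_CS _ _))// mulrC mulrAC.
  by rewrite ler_wpM2r ?nrm_ge0// h.
have [->|y0] := eqVneq (nrm y) 0; first by move=> _; rewrite mulr_ge0 ?nrm_ge0 ?ltW.
by rewrite ler_pM2r// lt_def y0 nrm_ge0.
Qed.

Lemma upper_monom t r j : upper_recovered (monom t r r) -> (j <= r)%N ->
  upper_recovered (monom t j j).
Proof.
case: j => [_ _|j ur]; first by rewrite monom0; exact: recovered_upper recovered1.
case: r ur => // r ur jr e e0.
have [C C0 hC] := shift_pow_near commA t j.+1.
(* The shift [d] is at most [1] for the uniform constant [C], and small enough that returning from
   [(c + d) ^+ j.+1] to [c ^+ j.+1] costs at most [e]. *)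
pose d := Num.min 1 (e / (C + 1)).
have C1 : 0 < C + 1 by rewrite ltr_wpDl.
have d0 : 0 < d by rewrite lt_min ltr01 divr_gt0.
have d1 : d <= 1 by rewrite ge_min lexx.
have dC : d * C <= e.
  have : d <= e / (C + 1) by rewrite ge_min lexx orbT.
  by rewrite ler_pdivlMr//; nra.
have := ur (d ^+ r.+1) (exprn_gt0 _ d0); apply: filterS => k h x.
have le_shift y := le_trans (h y) (shift_pow_gt commA t rp r y d0).
apply: le_trans (moment_le commA rp (cpP k) d0 le_shift jr x) _.
rewrite -lerBlDl -ripBl -bop_subE -(repB rp) (le_trans (rip_CS _ _))// expr2 mulrA.
rewrite ler_wpM2r ?nrm_ge0// (le_trans (rep_contractive rp commA _ _))//.
by rewrite ler_wpM2r ?nrm_ge0// (le_trans (hC d _))// d0.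
Qed.

(* For commuting [a] and [b] the operator matrix with entries
   [a^* a, a^* b, b^* a, b^* b] kills [(b x, - a x)], so once the matrix is
   asymptotically recovered from above, [a] and [b] can be exchanged. *)
Lemma exchange a b : upper_recovered (star a * a) -> upper_recovered (star b * b) ->
  recovered (star a * b) -> forall z,
  asymp (fun k => Psi k (z * a) * rho b) (fun k => Psi k (z * b) * rho a).
Proof.
move=> ua ub rab z e e0.
have [Ma Ma0 hMa] := bop_bounded (rho a); have [Mb Mb0 hMb] := bop_bounded (rho b).
pose M := Ma + Mb; have M0 : 0 < M by rewrite addr_gt0.
(* The three terms of [cp_schwarz] are compared with [nrm (rho (a * b) x) ^+ 2], which cancels with
   coefficients [1 - 2 + 1]. The errors total at most [4 d M^2 nrm x ^ 2]; the [+ 1] keeps [K]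
   positive when [z = 0]. *)
pose K := (nrm z ^+ 2 + 1) * (4 * M ^+ 2).
have K0 : 0 < K.
  by rewrite mulr_gt0 ?mulr_gt0 ?exprn_gt0// ltr_wpDl// sqr_ge0.
pose d := e ^+ 2 / K; have d0 : 0 < d by rewrite divr_gt0 ?exprn_gt0.
move: (ua d d0) (ub d d0) (rab d d0); apply: filterS3 => k ha hb hab x.
have e0' : 0 <= e * nrm x by rewrite mulr_ge0 ?nrm_ge0 ?ltW.
have := cp_schwarz (cpP k) z a b (rho b x) (rho a x).
set N := nrm _ => h; rewrite -/N.
suff : N ^+ 2 <= (e * nrm x) ^+ 2 by rewrite ler_pXn2r ?nnegrE ?nrm_ge0.
apply: le_trans h _.
have ax := hMa x; have bx := hMb x.
have aM : nrm (rho a x) <= M * nrm x.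
  by rewrite (le_trans ax)// ler_wpM2r ?nrm_ge0// lerDl ltW.
have bM : nrm (rho b x) <= M * nrm x.
  by rewrite (le_trans bx)// ler_wpM2r ?nrm_ge0// lerDr ltW.
have := ha (rho b x); have := hb (rho a x); have := hab (rho a x).
rewrite !(rip_starM rp) -!(repM_apply rp) (commA b a).
have := rip_CSN
  (Psi k (star a * b) (rho a x) - rho (star a * b) (rho a x)) (rho b x).
rewrite ripBl.
have -> : rip (rho (star a * b) (rho a x)) (rho b x) = nrm (rho (a * b) x) ^+ 2.
  by rewrite -rip_sq !(repM_apply rp) (rep_adj' rp) -!(repM_apply rp) (commA b a).
rewrite bop_subE.
set E1 := nrm (_ - _); set P := rip (Psi k _ _) _.
move=> h1 h2 h3 h4.
have E0 := nrm_ge0 (Psi k (star a * b) (rho a x) - rho (star a * b) (rho a x)).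
rewrite -/E1 in E0.
set X := nrm x in ax bx aM bM e0' *.
have X0 : 0 <= X := nrm_ge0 x.
have sa : nrm (rho a x) ^+ 2 <= M ^+ 2 * X ^+ 2.
  by rewrite -exprMn ler_pXn2r ?nnegrE ?mulr_ge0 ?nrm_ge0 ?(ltW M0).
have sb : nrm (rho b x) ^+ 2 <= M ^+ 2 * X ^+ 2.
  by rewrite -exprMn ler_pXn2r ?nnegrE ?mulr_ge0 ?nrm_ge0 ?(ltW M0).
have sab : E1 * nrm (rho b x) <= d * (M ^+ 2 * X ^+ 2).
  rewrite (le_trans (ler_wpM2r (nrm_ge0 _) h2))// -mulrA ler_wpM2l ?(ltW d0)//.
  by rewrite -exprMn expr2 ler_pM ?nrm_ge0.
have := ler_wpM2l (ltW d0) sa; have := ler_wpM2l (ltW d0) sb => sb' sa'.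
have dK : d * K = e ^+ 2 by rewrite /d divfK// gt_eqF.
have -> : (e * X) ^+ 2 = (nrm z ^+ 2 + 1) * (4 * (d * (M ^+ 2 * X ^+ 2))).
  by rewrite exprMn -dK /K; ring.
apply: le_trans (ler_wpM2l (sqr_ge0 _) _)
  (_ : nrm z ^+ 2 * (4 * (d * (M ^+ 2 * X ^+ 2))) <= _).
  by lra.
rewrite ler_wpM2r ?lerDl//.
by rewrite mulr_ge0// mulr_ge0 ?(ltW d0)// mulr_ge0 ?sqr_ge0.
Qed.

Lemma recovered_bound a : exists2 C : R, 0 < C &
  forall k x, nrm ((Psi k a - rho a) x) <= C * nrm x.
Proof.
exists (2 * nrm a + 1) => [|k x]; first by rewrite ltr_wpDl// mulr_ge0 ?nrm_ge0.
rewrite bop_subE (le_trans (nrmB _ _))//.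
have := cp_contractive (cpP k) a x; have := rep_contractive rp commA a x.
by have := nrm_ge0 x; nra.
Qed.

(** Expanding [nrm x ^+ 2] gives three nonnegative terms, each bounded by the sum. The splitting of
    [x] serves to cancel a right factor [rho (star w * w)]. *)
Lemma resolvent_bounds w (e : R) : 0 < e -> forall x, exists v,
  [/\ x = rho (star w * w) v + e%:C%C *: v, nrm (rho (star w * w) v) <= nrm x,
      e * nrm v <= nrm x &
      2 * e * rip (rho (star w * w) v) v <= nrm x ^+ 2].
Proof.
move=> e0 x; have [v vx] := shifted_square_onto rp w e0 x; exists v.
have : nrm x ^+ 2 = nrm (rho (star w * w) v) ^+ 2
    + 2 * e * rip (rho (star w * w) v) v + (e * nrm v) ^+ 2.
  rewrite -rip_sq -vx !(ripDl, ripDr, ripZl, ripZr) exprMn -!rip_sq.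
  by rewrite (ripC v); ring.
have := rip_starM rp w v => wv; have wv0 : 0 <= rip (rho (star w * w) v) v.
  by rewrite wv sqr_ge0.
have ewv : 0 <= 2 * e * rip (rho (star w * w) v) v.
  by rewrite mulr_ge0// mulr_ge0// ltW.
have p1 := sqr_ge0 (nrm (rho (star w * w) v)); have p2 := sqr_ge0 (e * nrm v).
move=> xE; split; [by rewrite vx| | |by rewrite xE; lra].
  by rewrite -(@ler_pXn2r _ 2) ?nnegrE ?nrm_ge0// xE; lra.
by rewrite -(@ler_pXn2r _ 2) ?nnegrE ?mulr_ge0 ?nrm_ge0 ?(ltW e0)// xE; lra.
Qed.

(** With [x = X v + d v], [Q X x = Q X^2 v + d Q X v]; the last term is at most [d C nrm x]
    uniformly in [k]. *)
Lemma vanishing_mul_square w a :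
  vanishing (fun k => (Psi k a - rho a) * rho (star w * w) * rho (star w * w)) ->
  vanishing (fun k => (Psi k a - rho a) * rho (star w * w)).
Proof.
move=> van e e0; have [C C0 hC] := recovered_bound a.
have d0 : 0 < e / (2 * C) by rewrite divr_gt0// mulr_gt0.
set d := _ / _ in d0.
(* The factor [d] compensates [nrm v], which can be as large as [nrm x / d]. *)
have := van (e / 2 * d) (mulr_gt0 (divr_gt0 e0 (ltr0n R 2)) d0).
apply: filterS => k h x; have [v [xE Xv dv _]] := resolvent_bounds w d0 x.
set X := rho (star w * w) in h xE Xv *; set Q := Psi k a - rho a in h hC *.
rewrite bop_mulE {1}xE bopD bopZ bopD bopZ.
rewrite (le_trans (nrmD _ _))// nrmZ ger0_norm ?(ltW d0)//.
have h1 : nrm (Q (X (X v))) <= e / 2 * nrm x.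
  rewrite (le_trans (h v))// -mulrA ler_wpM2l// ltW// divr_gt0//.
have h2 : d * nrm (Q (X v)) <= e / 2 * nrm x.
  have -> : e / 2 = d * C by rewrite /d invfM mulrA divfK ?gt_eqF.
  by rewrite -(mulrA d) ler_wpM2l ?(ltW d0)// (le_trans (hC k _))// ler_wpM2l// ltW.
by rewrite [e]splitr mulrDl lerD.
Qed.

(** For positive [B = Phi b], Cauchy-Schwarz in the form of [B] bounds [B^2] by [nrm b] times [B];
    [cp_mono] then bounds [B]. *)
Lemma cp_sq_le (Phi : A -> bop H) w u x : cp_unital Phi ->
  nrm (Phi (star (w * u) * (w * u)) x) ^+ 2 <=
  nrm (star (w * u) * (w * u)) * (nrm w ^+ 2 * rip (Phi (star u * u) x) x).
Proof.
move=> cP; set b := star (w * u) * (w * u).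
have := cp_CS cP (w * u) (w * u) (Phi b x) x; rewrite -/b rip_sq => h.
have hb : rip (Phi b (Phi b x)) (Phi b x) <= nrm b * nrm (Phi b x) ^+ 2.
  rewrite (le_trans (rip_CS _ _))// expr2 mulrA ler_wpM2r ?nrm_ge0//.
  exact: cp_contractive.
have b0 := cp_ge0 cP (w * u) x; rewrite -/b in b0.
have hx : rip (Phi b x) x <= nrm w ^+ 2 * rip (Phi (star u * u) x) x.
  exact: cp_mono.
move: (nrm (Phi b x) ^+ 2) (sqr_ge0 (nrm (Phi b x))) h hb => N N0 h hb.
apply: le_trans (_ : nrm b * rip (Phi b x) x <= _); last first.
  by rewrite ler_wpM2l ?nrm_ge0.
have [->|N1] := eqVneq N 0; first by rewrite mulr_ge0 ?nrm_ge0.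
have {}N1 : 0 < N by rewrite lt_def N1.
rewrite -(ler_pM2r N1) -expr2 (le_trans h)// mulrAC.
by rewrite ler_wpM2r.
Qed.

(** The range of [X = rho (star u * u)] need not be dense, so in [x = X v + m v] the remainder must
    be controlled: [a] contains [star u * u], and by [cp_sq_le] both [Psi k a] and [rho a] send
    [m v] to a vector of norm of order [sqrt m * nrm x]. *)
Lemma recovered_cancel w u : let a := star (w * u) * (w * u) in
  upper_recovered (star u * u) ->
  vanishing (fun k => (Psi k a - rho a) * rho (star u * u)) -> recovered a.
Proof.
move=> a up van tau tau0; pose M := nrm a * nrm w ^+ 2 + 1.
have M0 : 0 < M by rewrite ltr_wpDl// mulr_ge0 ?nrm_ge0 ?sqr_ge0.
(* Chosen so that [m * M <= tau ^+ 2 / 9]: each of the three error terms is then at most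
   [tau / 3 * nrm x]. *)
pose m := Num.min 1 (tau ^+ 2 / (9 * M)).
have m0 : 0 < m by rewrite lt_min ltr01 divr_gt0 ?exprn_gt0// mulr_gt0.
have m1 : m <= 1 by rewrite ge_min lexx.
have mM : m * (9 * M) <= tau ^+ 2.
  by rewrite -ler_pdivlMr ?mulr_gt0// ge_min lexx orbT.
have tm0 : 0 < tau / 3 * m by rewrite mulr_gt0// divr_gt0.
have m20 : 0 < m / 2 by rewrite divr_gt0.
move: (up _ m20) (van _ tm0); apply: filterS2 => k hup hvan x.
have [v [xE _ mv Xv]] := resolvent_bounds u m0 x.
set X := rho (star u * u) in xE Xv hvan *.
have part (Phi : A -> bop H) : cp_unital Phi ->
    rip (Phi (star u * u) v) v <= rip (X v) v + m / 2 * nrm v ^+ 2 ->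
    m * nrm (Phi a v) <= tau / 3 * nrm x.
  move=> cP hPhi; have := cp_sq_le w u v cP; rewrite -/a => h.
  rewrite -(@ler_pXn2r _ 2) ?nnegrE ?mulr_ge0 ?nrm_ge0 ?(ltW m0) ?(ltW tau0)
    ?invr_ge0//.
  rewrite !exprMn; apply: le_trans (ler_wpM2l (sqr_ge0 _) h) _.
  have X0 : 0 <= nrm x ^+ 2 by rewrite sqr_ge0.
  have mv2 : m ^+ 2 * nrm v ^+ 2 <= nrm x ^+ 2.
    by rewrite -exprMn ler_pXn2r ?nnegrE ?mulr_ge0 ?nrm_ge0 ?(ltW m0).
  have hm : m ^+ 2 * rip (Phi (star u * u) v) v <= m * nrm x ^+ 2.
    apply: le_trans (ler_wpM2l (sqr_ge0 _) hPhi) _.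
    have := ler_wpM2l (ltW m0) Xv; have := ler_wpM2l (ltW m0) mv2; nra.
  have B0 : 0 <= nrm a * nrm w ^+ 2 by rewrite mulr_ge0 ?nrm_ge0 ?sqr_ge0.
  rewrite mulrA mulrCA; apply: le_trans (ler_wpM2l B0 hm) _.
  have := ler_wpM2r X0 mM; have : 0 <= m * nrm x ^+ 2 by rewrite mulr_ge0 ?(ltW m0).
  rewrite /M => h1 h2.
  have -> : tau ^+ 2 * 3^-1 ^+ 2 = tau ^+ 2 / 9 by field.
  nra.
have p1 := part _ (cpP k) (hup v).
have p2 : m * nrm (rho a v) <= tau / 3 * nrm x.
  apply: part; first exact: rep_cp_unital.
  by rewrite lerDl mulr_ge0 ?sqr_ge0 ?(ltW m20).
have h1 : nrm ((Psi k a - rho a) (X v)) <= tau / 3 * nrm x.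
  rewrite (le_trans (hvan v))// -mulrA ler_wpM2l// ltW// divr_gt0//.
have h2 : m * nrm ((Psi k a - rho a) v) <= tau / 3 * nrm x + tau / 3 * nrm x.
  apply: le_trans (ler_wpM2l (ltW m0) (nrmB _ _)) _.
  by rewrite mulrDr lerD.
rewrite {1}xE bopD bopZ (le_trans (nrmD _ _))// nrmZ ger0_norm ?(ltW m0)//.
by lra.
Qed.

End Asymptotics.

Lemma asymp_eq (R : realType) (H : hilbertType R) (X X' Y Y' : nat -> bop H) :
  asymp X Y -> X =1 X' -> Y =1 Y' -> asymp X' Y'.
Proof. by move=> XY /funext <- /funext <-. Qed.

(** * Recovery of powers of [c] along an arithmetic progression *)

Section NormalGenerator.
Context {R : realType} {A : cstarAlgType R} {H : hilbertType R}.
Hypothesis commA : forall a b : A, a * b = b * a.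
Variables (rho : A -> bop H) (Psi : nat -> A -> bop H) (t : A).
Hypotheses (rp : representation rho) (cpP : forall k, cp_unital (Psi k)).

Let c n := monom t n n.
Let recov := recovered rho Psi.
Let upper := upper_recovered rho Psi.

Let cM m n : c m * c n = c (m + n). Proof. exact: monomM. Qed.
Let rcM m n : rho (c m) * rho (c n) = rho (c (m + n)).
Proof. by rewrite -(repM rp) cM. Qed.

(** [exchange] is used for [(a, b)] and then for [(star a, star b)]; both
    [Psi (z * star a * a) rho (star b * b)] and its mirror image are asymptotic to
    [Psi (z * star a * b) rho (a * star b)]. *)
Lemma exchange_moduli i j k l :
  upper (c (i + j)) -> upper (c (k + l)) -> recov (monom t (j + k) (i + l)) ->
  forall z, asymp (fun n => Psi n (z * c (i + j)) * rho (c (k + l)))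
                  (fun n => Psi n (z * c (k + l)) * rho (c (i + j))).
Proof.
move=> ud ue rec z; set a := monom t i j; set b := monom t k l.
have E1 := @exchange _ _ _ commA rho Psi rp cpP a b.
rewrite !monom_sq// monom_star// monomM// in E1.
have := asymp_mulr (rho (star b)) (E1 ud ue rec (z * star a)).
have E2 := @exchange _ _ _ commA rho Psi rp cpP (star a) (star b).
rewrite !starK !(commA _ (star _)) !monom_sq// monom_star// monomM// in E2.
have rec' : recov (monom t (l + i) (k + j)).
  by rewrite addnC (addnC k) -(monom_star commA); exact: recovered_star.
have := asymp_mulr (rho a) (E2 ud ue rec' (z * b)).
rewrite /a /b !monom_star// => h2 h1.
apply: (@asymp_trans _ _ (fun n => Psi n (z * monom t (j + k) (i + l)) *
  rho (monom t (l + i) (k + j)))).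
- apply: (asymp_eq h1) => n; rewrite -mulrA -(repM rp) -mulrA !monomM//.
    by rewrite (addnC j) (addnC l).
  by rewrite (addnC i) (addnC j).
- apply: (asymp_eq h2) => n; rewrite -mulrA -(repM rp) -mulrA !monomM//.
    by rewrite (addnC k) (addnC l).
  by rewrite (addnC l) (addnC j).
Qed.

Section Progression.
Variables d e : nat.
Hypotheses (de : (d < e)%N) (ue : upper (c e))
  (cd : asymp (fun k => Psi k (c d) * rho (c e)) (fun=> rho (c (d + e))))
  (exch : forall z, asymp (fun k => Psi k (z * c d) * rho (c e))
                          (fun k => Psi k (z * c e) * rho (c d))).

Lemma exchange_progression n z :
  asymp (fun k => Psi k (z * c (d + n * (e - d))) * rho (c d))
        (fun k => Psi k (z * c d) * rho (c (d + n * (e - d)))).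
Proof.
set g := (e - d)%N; elim: n z => [|n ih] z; first by rewrite addn0; exact: asymp_refl.
have dg : (d + g = e)%N by rewrite /g subnKC// ltnW.
apply: (@asymp_trans _ _ (fun k => Psi k (z * c e) * rho (c (d + n * g)))).
  apply: (asymp_eq (ih (z * c g))) => k; rewrite -mulrA cM.
    by rewrite addnCA mulSn.
  by rewrite addnC dg.
apply: asymp_sym; apply: (asymp_eq (asymp_mulr (rho (c (n * g))) (exch z))) => k.
  by rewrite -mulrA rcM -dg -addnA mulSn.
by rewrite -mulrA rcM.
Qed.

(** The two exchanges recover [c J] up to a right factor [rho (c (d + e))], which is then cancelled.
    Starting at [n.+1] ensures [e <= J], so that [c e] divides [c J]. *)
Lemma recovered_progression n : recov (c (d + n.+1 * (e - d))).
Proof.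
set J := (d + _)%N.
have eJ : (e <= J)%N by rewrite /J mulSn addnA subnKC ?leq_addr// ltnW.
have h1 := asymp_mulr (rho (c e)) (exchange_progression n.+1 1).
have h2 := asymp_mulr (rho (c J)) cd.
have h3 : asymp (fun k => Psi k (c J) * rho (c (d + e)))
                (fun=> rho (c J) * rho (c (d + e))).
  apply: (@asymp_trans _ _ (fun k => Psi k (c d) * rho (c (e + J)))).
    apply: (asymp_eq h1) => k; rewrite !mul1r -mulrA rcM//.
    by rewrite addnC.
  apply: (asymp_eq h2) => k; first by rewrite -mulrA rcM.
  by rewrite rcM rcM addnC.
(* The extra factor turns [c (d + e)] into [c e * c e], the shape required by
   [vanishing_mul_square]. *)
have h4 := asymp_mulr (rho (c (e - d))) h3.
have sqE m : star (monom t 0 m) * monom t 0 m = c m by rewrite monom_sq.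
have ce2 (S : bop H) :
    S * rho (c (d + e)) * rho (c (e - d)) = S * rho (c e) * rho (c e).
  by rewrite -!mulrA !rcM addnC addnA subnK// ltnW.
have h5 : vanishing (fun k => (Psi k (c J) - rho (c J)) * rho (c e)).
  rewrite -(sqE e); apply: vanishing_mul_square => //.
  move=> eps /h4; apply: filterS => k h x; apply: le_trans (h x).
  by rewrite sqE !ce2 !mulrBl.
have JE : monom t 0 (J - e) * monom t 0 e = monom t 0 J by rewrite monomM// subnK.
have := @recovered_cancel _ _ _ commA rho Psi rp cpP
  (monom t 0 (J - e)) (monom t 0 e).
by rewrite JE !sqE => /(_ ue h5).
Qed.

End Progression.

Lemma upper_monom_all p q r : p != q -> (p + q < 2 * r)%N ->
  recov (monom t p q) -> recov (c r) -> forall n, upper (c n).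
Proof.
move=> pq pqr rpq rr.
have ur j : (j <= r)%N -> upper (c j).
  by apply: upper_monom => //; exact: recovered_upper.
(* The subtraction is truncated, so [e] is the minimum of [r] and [p + q]. If [d > 0], then
   [d < e = r] by [p + q < 2 * r]; if [d = 0], then [e = p + q > 0]. *)
pose d := (p + q - r)%N; pose j := minn p d; pose i := (d - j)%N.
have [jp iq ijd] : [/\ (j <= p)%N, (i <= q)%N & (i + j = d)%N].
  by rewrite /i /j /d; split; lia.
pose e := (p - j + (q - i))%N.
have eE : e = (p + q - d)%N by rewrite /e; lia.
have [de er] : (d < e)%N /\ (e <= r)%N by rewrite eE /d; split; lia.
have ud : upper (c (i + j)) by rewrite ijd; apply/ur/(leq_trans (ltnW de)).
have rec : recov (monom t (j + (p - j)) (i + (q - i))) by rewrite !subnKC.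
have exch := exchange_moduli ud (ur _ er : upper (c (p - j + (q - i)))) rec.
rewrite ijd -/e in exch.
have cd : asymp (fun k => Psi k (c d) * rho (c e)) (fun=> rho (c (d + e))).
  (* For [d = 0] this is [Psi k 1 = 1]; otherwise [e = r], and after an exchange the recovery of
     [c r] applies. *)
  have [d0|d0] := posnP d.
    apply: (asymp_eq (asymp_refl (fun=> rho (c e)))) => k; last by rewrite d0.
    by rewrite d0 /c monom0 (cp1 (cpP k)) mul1r.
  have er' : e = r by rewrite eE /d in d0 *; lia.
  apply: (@asymp_trans _ _ (fun k => Psi k (c e) * rho (c d))).
    by apply: (asymp_eq (exch 1)) => k; rewrite mul1r.
  rewrite er'; apply: (asymp_eq (asymp_mulr (rho (c d)) rr)) => k //.
  by rewrite rcM addnC.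
(* The index reached is at least [n] because [e - d >= 1]. *)
move=> n; have rec_n := recovered_progression de (ur _ er) cd exch n.
apply: (upper_monom commA rp cpP (recovered_upper rec_n)).
have := leq_pmulr n.+1 (_ : 0 < e - d)%N; rewrite subn_gt0 de => /(_ isT).
by move=> h; apply: leq_trans (leqnSn n) (leq_trans h (leq_addl _ _)).
Qed.

End NormalGenerator.

(** * The asymptotic multiplicative domain *)

Section MultiplicativeElements.
Context {R : realType} {A : cstarAlgType R} {H : hilbertType R}.
Hypothesis commA : forall a b : A, a * b = b * a.
Variables (rho : A -> bop H) (Psi : nat -> A -> bop H).
Hypotheses (rp : representation rho) (cpP : forall k, cp_unital (Psi k)).

(** Quantifying over [z] is what lets the property pass to products. *)
Definition asymp_multiplicative a := forall z,
  asymp (fun k => Psi k (z * a)) (fun k => Psi k z * rho a).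

Lemma asymp_multiplicative_recovered a :
  asymp_multiplicative a -> recovered rho Psi a.
Proof.
move=> /(_ 1) ma; apply: (asymp_eq ma) => k; first by rewrite mul1r.
by rewrite (cp1 (cpP k)) mul1r.
Qed.

(** This is [exchange] with [b = 1]. *)
Lemma upper_asymp_multiplicative a : upper_recovered rho Psi (star a * a) ->
  recovered rho Psi a -> asymp_multiplicative a.
Proof.
move=> ua ra z; have r1 := recovered1 rp cpP.
have := @exchange _ _ _ commA rho Psi rp cpP a 1 ua.
rewrite cstar1 !mulr1 => /(_ (recovered_upper r1) (recovered_star rp cpP ra) z) h.
by apply: (asymp_eq h) => k; rewrite ?(rep1 rp) ?mulr1.
Qed.

Lemma asymp_multiplicativeD a b :
  asymp_multiplicative a -> asymp_multiplicative b -> asymp_multiplicative (a + b).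
Proof.
move=> ma mb z; have := vanishingD (ma z) (mb z); rewrite /asymp => v e /v.
apply: filterS => k h x; apply: le_trans (h x).
by rewrite mulrDr (cpD (cpP k)) (repD rp) mulrDr opprD addrACA.
Qed.

Lemma asymp_multiplicativeZ (s : R[i]) a :
  asymp_multiplicative a -> asymp_multiplicative (s *: a).
Proof.
move=> ma z; have := vanishing_scale s (ma z); rewrite /asymp => v e /v.
apply: filterS => k h x; apply: le_trans (h x).
rewrite -cscaleAr (cpZ (cpP k)) (repZ rp) !bop_subE !bop_mulE !bop_scaleE.
by rewrite bop_subE scalerBr bopZ.
Qed.

Lemma asymp_multiplicativeM a b :
  asymp_multiplicative a -> asymp_multiplicative b -> asymp_multiplicative (a * b).
Proof.
move=> ma mb z; apply: (asymp_trans (Y := fun k => Psi k (z * a) * rho b)).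
  by apply: (asymp_eq (mb (z * a))) => k //; rewrite mulrA.
by apply: (asymp_eq (asymp_mulr (rho b) (ma z))) => k //; rewrite (repM rp) mulrA.
Qed.

Lemma asymp_multiplicative_closed a :
  (forall e : R, 0 < e -> exists2 b, asymp_multiplicative b & nrm (a - b) <= e) ->
  asymp_multiplicative a.
Proof.
move=> cl z e e0; pose m := nrm z + 1; have z0 : 0 <= nrm z := nrm_ge0 z.
have m0 : 0 < m by rewrite ltr_wpDl.
have d0 : 0 < e / (3 * m) by rewrite divr_gt0// mulr_gt0.
have [b mb ab] := cl _ d0.
have := mb z (e / 3) (divr_gt0 e0 (ltr0n R 3)); apply: filterS => k h x.
have zab : nrm z * nrm (a - b) <= e / 3.
  apply: le_trans (ler_wpM2l z0 ab) _.
  have -> : e / 3 = e / (3 * m) * m by field; rewrite gt_eqF.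
  by rewrite mulrC ler_wpM2l ?(ltW d0)// lerDl.
have -> : (Psi k (z * a) - Psi k z * rho a) x =
    (Psi k (z * b) - Psi k z * rho b) x
    + (Psi k (z * (a - b)) x - Psi k z (rho (a - b) x)).
  rewrite mulrBr (cpB (cpP k)) (repB rp) !bop_subE bopB !bop_mulE opprB.
  by rewrite addrACA [X in _ = X + _]addrC subrK addKr.
have h1 : nrm (Psi k (z * (a - b)) x) <= e / 3 * nrm x.
  rewrite (le_trans (cp_contractive (cpP k) _ _))// ler_wpM2r ?nrm_ge0//.
  exact: le_trans (nrmM _ _) zab.
have h2 : nrm (Psi k z (rho (a - b) x)) <= e / 3 * nrm x.
  rewrite (le_trans (cp_contractive (cpP k) _ _))//.
  apply: le_trans (ler_wpM2l z0 (rep_contractive rp commA _ _)) _.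
  by rewrite mulrA ler_wpM2r ?nrm_ge0.
apply: le_trans (nrmD _ _) _; have := h x.
have := nrmB (Psi k (z * (a - b)) x) (Psi k z (rho (a - b) x)); lra.
Qed.

(** Imposing the property on adjoints as well makes the set stable under [star]. *)
Lemma asymp_multiplicative_subalgebra :
  cstar_subalgebra [set a | asymp_multiplicative a /\ asymp_multiplicative (star a)].
Proof.
split=> [a b [ma ma'] [mb mb']|s a [ma ma']|a b [ma ma'] [mb mb']|a [ma ma']|] /=.
- by rewrite starD; split; exact: asymp_multiplicativeD.
- by rewrite starZ; split; exact: asymp_multiplicativeZ.
- by rewrite cstarM; split; exact: asymp_multiplicativeM.
- by rewrite starK.
move=> a cla; have approx (e : R) : 0 < e -> exists2 b,
    asymp_multiplicative b /\ asymp_multiplicative (star b) & nrm (a - b) <= e.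
  move=> e0; have [] := cla (ball a e%:C%C); first by apply: nbhsx_ballx; rewrite ltcR.
  move=> b [mb]; rewrite -ball_normE /= nrmE ltcR => /ltW ab; by exists b.
split; apply: asymp_multiplicative_closed => e /approx[b [mb mb'] ab].
  by exists b.
by exists (star b) => //; rewrite -cstarB nrm_star.
Qed.

End MultiplicativeElements.

Theorem theorem2p1 (R : realType) (A : cstarAlgType R) (t : A)
    (Xi : set (nat * nat)) :
  (forall a b : A, a * b = b * a) ->
  generates [set t] ->
  (exists p q r : nat,
    [/\ p != q, (p + q < 2 * r)%N, Xi (p, q) & Xi (r, r)]) ->
  let G := [set star t ^+ mn.1 * t ^+ mn.2 | mn in Xi] in
  generates G ->
  hyperrigid G.
Proof.
move=> commA _ [p [q [r [pq pqr Xpq Xrr]]]] G genG; split.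
  by exists (star t ^+ p * t ^+ q); exists (p, q).
move=> H rho Phi [rp _] ucpP conv a; pose Psi k := Phi k \o rho.
have cpP k : cp_unital (Psi k) by exact: ucp_cp_unital.
have recG m n : Xi (m, n) -> recovered rho Psi (monom t m n).
  by move=> Xmn; apply/vanishing_opnorm; apply: conv; exists (m, n).
have up := upper_monom_all commA rp cpP pq pqr (recG _ _ Xpq) (recG _ _ Xrr).
have multG m n : recovered rho Psi (monom t m n) ->
    asymp_multiplicative rho Psi (monom t m n).
  by move=> rec; apply: upper_asymp_multiplicative => //; rewrite monom_sq.
pose S := [set b | asymp_multiplicative rho Psi b /\
                   asymp_multiplicative rho Psi (star b)].
have GS : cstar_gen G `<=` S.
  apply: smallest_sub; first exact: asymp_multiplicative_subalgebra.
  move=> _ [[[m n] Xmn <-]|->] /=; rewrite -/(monom t _ _).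
    split; first exact/multG/recG.
    rewrite monom_star//; apply: multG; rewrite -(monom_star commA).
    exact/recovered_star/recG.
  (* The unit is the monomial with both exponents zero. *)
  have m1 := multG 0%N 0%N; rewrite monom0 in m1.
  by rewrite /S /= cstar1; split; apply/m1/recovered1.
have [ma _] : S a by apply: GS; rewrite genG.
exact/vanishing_opnorm/(asymp_multiplicative_recovered cpP).
Qed.
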